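(* Let $\mathfrak g$ be a symmetrizable Kac–Moody algebra over $\mathbb C$ with Cartan matrix $(a_{st})_{s,t\in\Delta}$, $\Delta$ finite. Let $I\subset\Delta$ be such that $a_{ij}\in\{0,-1\}$ for all $i\neq j$ in $I$ and such that $I$, as a full subgraph of the Dynkin diagram, has no cycle of length $\ge3$. Let $D\subset I$ be such that $\lambda_{D,I}=2\rho-\sum_{i\in I}\alpha_i-\sum_{d\in D}\alpha_d$ is dominant. Fix a root in each connected component of $I$ and a numbering of $\Delta$ adapted to $(I,D)$ (as defined in the context), put $N=|I|$, and identify $\Delta$ with $\{1,\dots,|\Delta|\}$ (so $I=\{1,\dots,N\}$). Let $\pi_{D,I}=f_D^{\nearrow}f_I^{\searrow}(\pi_1\otimes\cdots\otimes\pi_{|\Delta|})$ in $B_1\otimes\cdots\otimes B_{|\Delta|}$, and let $m_1<\cdots<m_t$ be the elements of the set $M$ defined in the context. Then $\pi_{D,I}=y_1\otimes\cdots\otimes y_{|\Delta|}$ where $$ y_k=\begin{cases} f_{\mathrm{DL}(k)}\,f_{L_r}\,f_k\pi_k & \text{if } k=m_r \text{ for some } r\in\{1,\dots,t\},\\ f_{\mathrm{DL}(k)}\,f_k\pi_k & \text{if } k \text{ is a receiving node, or } k \text{ is a ground point not in } M,\\ f_k\pi_k & \text{for all other } k\le N,\\ \pi_k & \text{if } k>N. \end{cases} $$ Here, in the first case, $f_{\mathrm{DL}(m_r)}=1$ if $m_r$ is an anchor point which is not a corolla point.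
   Context: **Weights and crystals.** $\rho$ satisfies $\langle\rho,\alpha_s^\vee\rangle=1$ for all $s$; a weight $\lambda$ is dominant if $\langle\lambda,\alpha_s^\vee\rangle\in\mathbb N$ for all $s$. $B_k$ is the crystal of the irreducible integrable module with highest weight the fundamental weight $\omega_k$ ($\langle\omega_k,\alpha_s^\vee\rangle=\delta_{ks}$, with $\sum_k\omega_k=\rho$), and $\pi_k\in B_k$ is its element of weight $\omega_k$. Write $\mathrm{wt}_s(x)=\langle\mathrm{wt}(x),\alpha_s^\vee\rangle$, $\varphi_s(x)=\max\{n:f_s^nx\ne0\}$. Tensor products of crystals follow the Bump–Schilling convention: for $x=x_1\otimes\cdots\otimes x_n$, $\varphi_s(x)=\max_j\big(\varphi_s(x_j)+\sum_{h<j}\mathrm{wt}_s(x_h)\big)$, and $f_s$ acts on the factor $x_j$, where $j$ is the first index at which this maximum is attained. Operators $f_s,f_t$ with $s\neq t$ non-adjacent in the Dynkin diagram commute on highest weight crystals. **Rooted forest.** Every component of $I$ is a tree. With a chosen root in each, orient edges towards the root; $x\to y$ means $x,y$ are adjacent and $y$ is next on the path from $x$ to the root; we say $x$ covers $y$, and $y=x^-$ is the predecessor of $x$. The height of $v$ is the number of edges from $v$ to its root. The adapted numbering: the elements of $I$ are numbered $1,\dots,N$ so that (1) larger height implies larger number, and (2) among elements of the same height, those of $I-D$ come before those of $D$; the elements of $\Delta-I$ are numbered arbitrarily $N+1,\dots,|\Delta|$. Elements of $I$ are compared through this numbering. $f_I^{\searrow}=f_N\cdots f_1$, and $f_D^{\nearrow}=\prod_{d\in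 D}f_d$ with indices increasing from left to right. **Leaves.** For $d\in D$ let $C_I(d)=\{i\in I: i\to d\}$, $c_I(d)=|C_I(d)|$, $C_D(d)=C_I(d)\cap D$. $D$ is regarded as a full subgraph of $I$; a leaf of $D$ is an element $d\in D$ with $C_D(d)=\varnothing$. The depth $\mathrm{dep}_D(d)$ is the maximal number of edges of an oriented path in $D$ from a leaf of $D$ to $d$. A leaf $d$ of $D$ is a vivid leaf if $c_I(d)\ge2$, and a dead leaf if $c_I(d)\le1$. If $d$ is a dead leaf, then (since $\lambda_{D,I}$ is dominant) $d^-$ exists in $I$, and $d^-\in D$ if $c_I(d)=0$; we call $d^-$ a receiving node if $d^-\in D$, and a ground point if $d^-\notin D$. $\mathrm{DL}$ is the set of dead leaves, $\mathrm{DL}(i)=\{d\in\mathrm{DL}:d\to i\}$ for $i\in I$, $f_{\mathrm{DL}(i)}=\prod_{j\in\mathrm{DL}(i)}f_j$ (commuting factors; equal to $1$ if $\mathrm{DL}(i)=\varnothing$), and $D^*=D-\mathrm{DL}$. **The functions $\sigma$ and $\mu$.** The function $\sigma:D^*\to I$ is defined recursively on depth: (1) if $\mathrm{dep}_D(d)=0$, i.e. $d$ is a vivid leaf, $\sigma(d)$ is the largest element of $C_I(d)$, and $\sigma(d)$ is called an anchor point; (2) if $\mathrm{dep}_D(d)=1$ and $C_D(d)$ contains only dead leaves, $\sigma(d)$ is the largest element of $C_D(d)$, called an anchor dead leaf; (3) in all other cases, the set $U(d)$ of those $d'\in C_D(d)$ such that $\sigma(d')$ is defined is non-empty and the values $\sigma(d')$,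 $d'\in U(d)$, are pairwise distinct, and $\sigma(d)=d^+$, where $d^+$ is the unique element of $U(d)$ such that $\sigma(d^+)$ is maximal. For $d\in D^*$, let $q$ be the largest integer such that the iterate $\sigma^q(d)$ is defined, and put $\mu(d)=\sigma^q(d)$; it is either an anchor point or an anchor dead leaf. **Gradient lines.** Let $M=\{\mu(d):d\in D^*\}=\{m_1<\cdots<m_t\}$. A corolla point is an element of $M$ that is also a ground point. For $i\in I$ let $\mathcal P(i)$ be the set consisting of $i$, $i^-$, $(i^-)^-$, and so on up to the root of its tree. For each $r$, let $L_r=\{m_r\}\cup\{d\in\mathcal P(m_r)\cap D^*:\mu(d)=m_r\}$; it is a chain $m_r\to m_r^1\to\cdots\to m_r^h=\ell_r$. Put $f_{L_r}=f_{\ell_r}\cdots f_{m_r^1}$ (the product over $L_r-\{m_r\}$, indices increasing from left to right).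
   Formalization: In rule (3) defining σ, d⁺ is taken as the element of U(d) with μ(d⁺) maximal instead of σ(d⁺) maximal; with the rule as stated the proposition fails, e.g. for the tree 2,3,4→1; 5,6→3; 7→4; 8→6 with D={1,3,4,6,7,8}. *)

(* Defs.v *)
From HB Require Import structures.
From mathcomp Require Import all_boot all_order all_algebra.
From mathcomp Require Import boolp reals.
From mathcomp Require Import complex.

Set Implicit Arguments.
Unset Strict Implicit.
Unset Printing Implicit Defensive.

Import Order.TTheory GRing.Theory Num.Theory.
Local Open Scope ring_scope.

Section Cartan.
Variables (Delta : finType) (a : Delta -> Delta -> int).

Definition gcm : Prop :=
  [/\ forall s, a s s = 2,
      forall s t, s != t -> a s t <= 0
    & forall s t, a s t = 0 -> a t s = 0].

Definition symmetrizer (d : Delta -> nat) : Prop :=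
  (forall s, (0 < d s)%N) /\
  (forall s t, (d s)%:Z * a s t = (d t)%:Z * a t s).

(* A realization over the complex numbers R[i]; it determines the Kac-Moody
   algebra, whose weights are the linear forms on [cartan]. *)
Record realization (R : realType) := Realization {
  cartan : vectType R[i];
  coroot : Delta -> cartan;
  sroot : Delta -> 'Hom(cartan, R[i]^o);
  coroot_free : free [seq coroot s | s <- enum Delta];
  sroot_free : free [seq sroot s | s <- enum Delta];
  sroot_coroot : forall s t, sroot t (coroot s) = (a s t)%:~R;
  cartan_dim :
    (\dim {: cartan} + \rank (\matrix_(i < #|Delta|, j < #|Delta|)
        ((a (enum_val i) (enum_val j))%:~R : R[i])) = 2 * #|Delta|)%N
}.

End Cartan.

Definition weight (Delta : finType) (a : Delta -> Delta -> int) (R : realType)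
  (g : realization a R) := 'Hom(cartan g, R[i]^o).

Definition Kq := {fraction {poly rat}}.

Definition qvar : Kq := tofrac ('X : {poly rat}).

Definition regular_at0 (x : Kq) : Prop :=
  exists n m : {poly rat}, m.[0] != 0 /\ x = tofrac n / tofrac m.

Definition qint (d : nat) (m : int) : Kq :=
  let x := qvar ^+ d in (x ^ m - x ^ (- m)) / (x - x^-1).

Definition qfact (d n : nat) : Kq := \prod_(1 <= i < n.+1) qint d i%:Z.

Section Quantum.
Variables (Delta : finType) (a : Delta -> Delta -> int) (d : Delta -> nat).
Variables (R : realType) (g : realization a R).

(* Divided power T^(n), for T = E_s or T = F_s. *)
Definition dpow (V : lmodType Kq) (s : Delta) (T : V -> V) (n : nat) (v : V) :=
  (qfact (d s) n)^-1 *: iter n T v.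

(* Weight modules over U_q(g) with integral weights: the torus element K_h
   acts on the space of weight mu by q^(mu h), so it is encoded by the grading,
   with K_s = q_s^(coroot s) and q_s = q^(d s). *)
Record uq_module := UqModule {
  uq_sort :> lmodType Kq;
  Eop : Delta -> {linear uq_sort -> uq_sort};
  Fop : Delta -> {linear uq_sort -> uq_sort};
  wsp : weight g -> uq_sort -> Prop;
  wsp0 : forall mu, wsp mu 0;
  wsp_lin : forall mu c u v, wsp mu u -> wsp mu v -> wsp mu (c *: u + v);
  wsp_span : forall v, exists (ms : seq (weight g)) (w : weight g -> uq_sort),
    (forall mu, mu \in ms -> wsp mu (w mu)) /\ v = \sum_(mu <- ms) w mu;
  wsp_direct : forall (ms : seq (weight g)) (w : weight g -> uq_sort),
    uniq ms -> (forall mu, mu \in ms -> wsp mu (w mu)) ->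
    \sum_(mu <- ms) w mu = 0 -> forall mu, mu \in ms -> w mu = 0;
  wsp_integral : forall mu v s, wsp mu v -> v <> 0 ->
    exists m : int, mu (coroot g s) = m%:~R;
  Eop_wt : forall s mu v, wsp mu v -> wsp (mu + sroot g s) (Eop s v);
  Fop_wt : forall s mu v, wsp mu v -> wsp (mu - sroot g s) (Fop s v);
  EF_rel : forall s t mu (m : int) v,
    wsp mu v -> mu (coroot g s) = m%:~R ->
    Eop s (Fop t v) - Fop t (Eop s v) =
      if s == t then qint (d s) m *: v else 0;
  E_serre : forall s t v, s != t ->
    let n := absz (1 - a s t) in
    \sum_(k < n.+1) (-1) ^+ k *:
       dpow s (Eop s) k (Eop t (dpow s (Eop s) (n - k) v)) = 0;
  F_serre : forall s t v, s != t ->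
    let n := absz (1 - a s t) in
    \sum_(k < n.+1) (-1) ^+ k *:
       dpow s (Fop s) k (Fop t (dpow s (Fop s) (n - k) v)) = 0
}.

Section Module.
Variable V : uq_module.

Definition integrable : Prop := forall s (v : V),
  (exists n, iter n (Eop V s) v = 0) /\ (exists n, iter n (Fop V s) v = 0).

(* Stability under the torus means stability under homogeneous components. *)
Definition submodule (W : V -> Prop) : Prop :=
  [/\ W 0,
      forall c u v, W u -> W v -> W (c *: u + v),
      forall s u, W u -> W (Eop V s u) /\ W (Fop V s u)
    & forall (ms : seq (weight g)) (w : weight g -> V),
        uniq ms -> (forall mu, mu \in ms -> wsp mu (w mu)) ->
        W (\sum_(mu <- ms) w mu) -> forall mu, mu \in ms -> W (w mu)].

Definition irreducible : Prop :=
  (exists v : V, v <> 0) /\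
  forall W : V -> Prop, submodule W ->
    (forall v, W v -> v = 0) \/ (forall v, W v).

Definition highest_weight_vector (lam : weight g) (u : V) : Prop :=
  [/\ u <> 0, wsp lam u & forall s, Eop V s u = 0].

(* Graph of Kashiwara's operator f~_s on homogeneous vectors:
   if u = \sum_n F_s^(n) w_n with w_n of weight mu + n alpha_s killed by E_s,
   then f~_s u = \sum_n F_s^(n+1) w_n. *)
Definition kashiwara_f (s : Delta) (u v : V) : Prop :=
  exists (mu : weight g) (N : nat) (w : nat -> V),
  [/\ forall n, wsp (mu + sroot g s *+ n) (w n),
      forall n, Eop V s (w n) = 0,
      u = \sum_(n < N) dpow s (Fop V s) n (w n)
    & v = \sum_(n < N) dpow s (Fop V s) n.+1 (w n)].

Inductive kstring (u : V) : V -> Prop :=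
  | KString0 : kstring u u
  | KStringS s v w : kstring u v -> kashiwara_f s v w -> kstring u w.

(* Kashiwara's lattice L(lambda): the span of the vectors f~ ... f~ u over the
   ring of rational functions regular at q = 0. *)
Definition klattice (u v : V) : Prop :=
  exists (n : nat) (c : 'I_n -> Kq) (w : 'I_n -> V),
  [/\ forall i, regular_at0 (c i), forall i, kstring u (w i)
    & v = \sum_i c i *: w i].

Definition qklattice (u v : V) : Prop :=
  exists2 w, klattice u w & v = qvar *: w.

End Module.

(* [wti s x] is the integer <wt x, alpha_s^vee>. *)
Record crystal := Crystal {
  crys_sort :> Type;
  wt : crys_sort -> weight g;
  ecr : Delta -> crys_sort -> option crys_sort;
  fcr : Delta -> crys_sort -> option crys_sort;
  eps : Delta -> crys_sort -> nat;
  phi : Delta -> crys_sort -> nat;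
  wti : Delta -> crys_sort -> int;
  ecrP : forall s x y, ecr s y = Some x <-> fcr s x = Some y;
  fcr_wt : forall s x y, fcr s x = Some y -> wt y = wt x - sroot g s;
  epsP : forall s x n,
    iter n (obind (ecr s)) (Some x) <> None <-> (n <= eps s x)%N;
  phiP : forall s x n,
    iter n (obind (fcr s)) (Some x) <> None <-> (n <= phi s x)%N;
  wtiP : forall s x, wt x (coroot g s) = (wti s x)%:~R;
  phi_eps : forall s x, (phi s x)%:Z = (eps s x)%:Z + wti s x
}.

(* [B] is the crystal of the irreducible integrable module V(lam) of highest
   weight lam, i.e. Kashiwara's B(lam): the nonzero classes of the vectors
   f~ ... f~ u in L(lam) / q L(lam), where [rep] picks a representative of each
   class. The operators e~ need no separate clause: on B(lam) they are the
   partial inverses of the f~, as they are in [B] by [ecrP]. *)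
Definition crystal_of_irreducible (lam : weight g) (B : crystal) : Prop :=
  exists (V : uq_module) (u : V) (rep : B -> V),
  [/\ integrable V, irreducible V & highest_weight_vector lam u] /\
  [/\ forall x, kstring u (rep x) /\ ~ qklattice u (rep x),
      forall x y, qklattice u (rep x - rep y) -> x = y,
      forall v, kstring u v -> ~ qklattice u v ->
        exists x, qklattice u (v - rep x),
      forall x, wsp (wt x) (rep x)
    & forall s x v, kashiwara_f s (rep x) v ->
        if fcr s x is Some y then qklattice u (v - rep y) else qklattice u v].

End Quantum.

(* The factors of a tensor product are ordered by [num]. *)
Section Tensor.
Variables (Delta : finType) (a : Delta -> Delta -> int).
Variables (R : realType) (g : realization a R).
Variables (num : Delta -> nat) (B : Delta -> crystal g).

Definition tensor := forall k : Delta, B k.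

Definition tensor_phi (s : Delta) (x : tensor) (j : Delta) : int :=
  (phi s (x j))%:Z + \sum_(h | (num h < num j)%N) wti s (x h).

(* The first index at which the maximum defining phi_s is attained. *)
Definition tensor_pos (s : Delta) (x : tensor) : option Delta :=
  [pick j | [forall h, tensor_phi s x h <= tensor_phi s x j]
            && [forall h, (num h < num j)%N ==>
                          (tensor_phi s x h < tensor_phi s x j)]].

Definition tensor_f (s : Delta) (x : tensor) : option tensor :=
  if tensor_pos s x is Some j then
    if fcr s (x j) is Some y then Some (dfwith x y) else None
  else None.

End Tensor.

(* The product f_(w_1) ... f_(w_r); the rightmost letter acts first. *)
Definition fword (Delta T : Type) (f : Delta -> T -> option T)
    (w : seq Delta) (x : T) : option T :=
  foldr (fun s => obind (f s)) (Some x) w.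

Section Forest.
Variables (Delta : finType) (a : Delta -> Delta -> int).
Variables (I D rts : {set Delta}) (num : Delta -> nat).

Definition adj : rel Delta :=
  [rel x y | [&& x \in I, y \in I, x != y & a x y != 0]].

Definition acyclic : Prop := forall p, ucycle adj p -> (size p <= 2)%N.

Definition root_choice : Prop :=
  rts \subset I /\
  forall i, i \in I -> exists! r, r \in rts /\ connect adj i r.

(* x :: p is the path from x to its root. *)
Definition rootpath (x : Delta) (p : seq Delta) : bool :=
  [&& path adj x p, uniq (x :: p) & last x p \in rts].

(* x --> y, i.e. y = x^- *)
Definition covers : rel Delta := fun x y => `[< exists p, rootpath x (y :: p) >].

(* In a forest there is a single n in the range of this maximum. *)
Definition height (x : Delta) : nat :=
  \max_(n < #|Delta| | `[< exists2 p, rootpath x p & size p = n >]) n.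

Definition adapted : Prop :=
  [/\ injective num,
      forall s, (1 <= num s <= #|Delta|)%N,
      forall s, s \in I -> (num s <= #|I|)%N,
      forall x y, x \in I -> y \in I -> (height x < height y)%N ->
        (num x < num y)%N
    & forall x y, x \in I :\: D -> y \in D -> height x = height y ->
        (num x < num y)%N].

Definition inc (X : {set Delta}) : seq Delta :=
  sort (fun s t => (num s <= num t)%N) (enum X).

Definition largest (X : {set Delta}) : option Delta :=
  [pick x in X | [forall y in X, (num y <= num x)%N]].

Definition C_I (d : Delta) : {set Delta} := [set i in I | covers i d].
Definition C_D (d : Delta) : {set Delta} := C_I d :&: D.

Definition leaf (d : Delta) : bool := (d \in D) && (C_D d == set0).
Definition vivid (d : Delta) : bool := leaf d && (2 <= #|C_I d|)%N.
Definition DL : {set Delta} := [set d | leaf d && (#|C_I d| <= 1)%N].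
Definition DL_at (i : Delta) : {set Delta} := [set d in DL | covers d i].
Definition Dstar : {set Delta} := D :\: DL.

Definition receiving (k : Delta) : bool :=
  [exists d in DL, covers d k] && (k \in D).
Definition ground (k : Delta) : bool :=
  [exists d in DL, covers d k] && (k \notin D).

Definition coversD : rel Delta :=
  [rel x y | [&& x \in D, y \in D & covers x y]].

Definition dep (d : Delta) : nat :=
  \max_(n < #|Delta| | `[< exists l p,
     [/\ leaf l, path coversD l p, last l p = d & size p = n] >]) n.

(* The last defined iterate of the partial map sg at d. *)
Definition last_iterate (sg : Delta -> option Delta) (d : Delta) :
    option Delta :=
  iter (\max_(q < #|Delta|.+1 | isSome (iter q (obind sg) (Some d))) q)
       (obind sg) (Some d).

Definition onum (o : option Delta) : nat := if o is Some s then num s else 0.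

(* [sigma_rec n] computes sigma at the elements of depth less than n. In the
   last case d^+ is the element d' of U(d) for which mu(d'), the end of the
   sigma-orbit of d', is maximal. Taking sigma(d') maximal instead can select a
   different element, since two elements of U(d) may have orbits of different
   lengths; the factors of pi_{D,I} then do not follow the gradient lines. *)
Fixpoint sigma_rec (n : nat) (d : Delta) : option Delta :=
  if n isn't n'.+1 then None
  else if d \notin Dstar then None
  else if dep d == 0%N then largest (C_I d)
  else if (dep d == 1%N) && (C_D d \subset DL) then largest (C_D d)
  else
    let sg := sigma_rec n' in
    let U := [set d' in C_D d | isSome (sg d')] in
    [pick x in U | [forall y in U,
       (onum (last_iterate sg y) <= onum (last_iterate sg x))%N]].

Definition sigma (d : Delta) : option Delta := sigma_rec (dep d).+1 d.

Definition mu (d : Delta) : option Delta := last_iterate sigma d.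

Definition anchor_point (m : Delta) : bool :=
  [exists d, vivid d && (sigma d == Some m)].

Definition M : {set Delta} := [set m | [exists d in Dstar, mu d == Some m]].

Definition corolla (m : Delta) : bool := (m \in M) && ground m.

(* The gradient line L_r, for m = m_r. *)
Definition Lline (m : Delta) : {set Delta} :=
  m |: [set d in Dstar | connect covers m d && (mu d == Some m)].

Definition yword (k : Delta) : seq Delta :=
  if k \in M then inc (DL_at k) ++ inc (Lline k :\ k) ++ [:: k]
  else if receiving k || ground k then inc (DL_at k) ++ [:: k]
  else if k \in I then [:: k]
  else [::].

End Forest.

(* Main.v *)
Require Import Defs.
From HB Require Import structures.
From mathcomp Require Import all_boot all_order all_algebra.
From mathcomp Require Import boolp reals.
From mathcomp Require Import complex ring zify.

Set Implicit Arguments.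
Unset Strict Implicit.
Unset Printing Implicit Defensive.

Import Order.TTheory GRing.Theory Num.Theory.
Local Open Scope ring_scope.

(* Let W_d(h) be the pairing of the weight of the h-th factor with the coroot of
   d, and eps_d(h) the value of eps_d there. The function whose first maximum
   decides where f_d acts is eps_d(j) + sum_(h <= j) W_d(h), and up to a
   correction of eps_d at the factor d itself it depends on weights only. While
   f_I acts, f_s is therefore placed on the factor s. When f_d acts (d in D), the
   partial sums increase by one at the parent of d, at each child of d, and at
   each factor that already carries f_c for a child c of d; they drop at the
   factor d. If d is a dead leaf the maximum is first attained at the parent d^-;
   otherwise it is attained at the last increment, which the recursion defining
   sigma identifies as mu(d).

   This determines the weight of every factor of the result. In B_k the word of
   the theorem is defined, and at each of its steps the weight pairs to 1 with
   the coroot of the letter; hence it ends at the only element of its weight, so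
   no commutation of the operators f_s has to be checked. The input from quantum
   groups is that the weights of B_k lie below omega_k and that omega_k has
   multiplicity one, which follows from U_q(sl_2)-theory: f~_s maps 0 to 0. *)

(** * Quantum integers and modules over U_q(g) *)

Section QuantumIntegers.

(** Degrees of polynomials show that q is no root of unity; this makes the quantum integers of
    nonzero argument invertible. *)
Lemma qvar_exp_eq1 (n : nat) : qvar ^+ n = 1 -> n = 0%N.
Proof.
rewrite /qvar -rmorphXn -(rmorph1 (@tofrac {poly rat})) => /eqP.
rewrite tofrac_eq => /eqP/(congr1 (size : {poly rat} -> nat)).
by rewrite size_polyXn size_poly1 => -[].
Qed.

Lemma qvar_neq0 : qvar != 0.
Proof. by rewrite /qvar tofrac_eq0 polyX_eq0. Qed.

Lemma qpow_neq0 (d : nat) : qvar ^+ d != 0.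
Proof. by rewrite expf_neq0 // qvar_neq0. Qed.

Lemma qpow_eq1 (d : nat) (m : int) : (0 < d)%N -> (qvar ^+ d) ^ m = 1 -> m = 0.
Proof.
have aux (n : nat) : (0 < d)%N -> (qvar ^+ d) ^+ n = 1 -> n = 0%N.
  by rewrite -exprM => d0 /qvar_exp_eq1/eqP;
    rewrite muln_eq0 eqn0Ngt d0 => /eqP.
move=> d0; case: m => n; rewrite ?NegzE; first by move/(aux n d0) ->.
by move/(congr1 GRing.inv); rewrite invr_expz opprK invr1 => /(aux n.+1 d0).
Qed.

Lemma qpow_sub_neq0 (d : nat) (m : int) : (0 < d)%N -> m != 0 ->
  (qvar ^+ d) ^ m - (qvar ^+ d) ^ (- m) != 0.
Proof.
move=> d0 m0; apply: contra m0; rewrite subr_eq0 => /eqP E.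
have := @qpow_eq1 d (m + m) d0; rewrite expfzDr ?qpow_neq0 //.
rewrite {2}E -expfzDr ?qpow_neq0 // subrr expr0z => /(_ erefl)/eqP.
by rewrite -mulr2n mulrn_eq0.
Qed.

Lemma qint_neq0 (d : nat) (m : int) : (0 < d)%N -> m != 0 -> qint d m != 0.
Proof.
move=> d0 m0; rewrite mulf_neq0 ?qpow_sub_neq0 // invr_neq0 //.
by have := @qpow_sub_neq0 d 1 d0 isT; rewrite expr1z exprN1.
Qed.

Lemma qint0 (d : nat) : qint d 0 = 0.
Proof. by rewrite /qint oppr0 subrr mul0r. Qed.

(** Induction step for the coefficients in the U_q(sl_2) formula for E F^n. In terms of A = x^j and
    B = x^p it is an identity of rational functions. *)
Lemma qint_mulS (d : nat) (p j : int) : (0 < d)%N ->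
  qint d (j + 1) * qint d (p - j) =
  qint d j * qint d (p - j + 1) + qint d (p - j - j).
Proof.
have aux (F : fieldType) (x A B : F) : x != 0 -> A != 0 -> B != 0 ->
  x - x^-1 != 0 ->
    (A * x - (A * x)^-1) / (x - x^-1) * ((B / A - (B / A)^-1) / (x - x^-1)) =
    (A - A^-1) / (x - x^-1) * ((B / A * x - (B / A * x)^-1) / (x - x^-1)) +
    (B / A / A - (B / A / A)^-1) / (x - x^-1).
  move=> x0 A0 B0 z0; field; rewrite x0 A0 B0 !andbT /=.
  (* The denominator still to be handled is x * x - 1 = x (x - x^-1). *)
  by move: z0; apply: contraNneq => E;
    rewrite -(mulfK x0 (x - _)) mulrBl mulVf // E mul0r.
move=> d0; rewrite /qint; set x := qvar ^+ d.
have x0 : x != 0 by exact: qpow_neq0.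
have z0 : x - x^-1 != 0 by have := @qpow_sub_neq0 d 1 d0 isT;
  rewrite expr1z exprN1.
rewrite -!invr_expz !(expfzDr _ _ x0) expr1z -!invr_expz.
move: (x ^ j) (expfz_neq0 j x0) (x ^ p) (expfz_neq0 p x0) => A A0 B B0.
move: x x0 z0 => x x0 z0.
exact: (aux _ _ _ _ x0 A0 B0 z0).
Qed.

Lemma qfact_neq0 (d n : nat) : (0 < d)%N -> qfact d n != 0.
Proof.
move=> d0; rewrite /qfact big_seq prodf_seq_neq0; apply/allP => i.
by rewrite mem_index_iota => /andP[i0 _]; apply/implyP => _;
  rewrite qint_neq0 // -lt0n.
Qed.

End QuantumIntegers.

(** * U_q(sl_2)-strings in integrable modules *)

Section QuantumModule.
Variables (Delta : finType) (a : Delta -> Delta -> int) (d : Delta -> nat).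
Hypotheses (a_gcm : gcm a) (d_gt0 : forall s, (0 < d s)%N).
Variables (R : realType) (g : realization a R).

Lemma sroot_nat s n t : (sroot g s *+ n) (coroot g t) = (a t s)%:~R *+ n.
Proof.
elim: n => [|n IHn]; first by rewrite !mulr0n zero_lfunE.
by rewrite !mulrS add_lfunE IHn sroot_coroot.
Qed.

Lemma weightBn (nu : weight g) s n t : (nu - sroot g s *+ n) (coroot g t) =
  nu (coroot g t) - (a t s)%:~R *+ n.
Proof. by rewrite add_lfunE opp_lfunE sroot_nat. Qed.

Variable V : uq_module d g.
Implicit Types (s : Delta) (nu : weight g) (v w : V).

(** For distinct weights, [v] in one and [- v] in the other would form a vanishing sum of
    homogeneous vectors, against directness. *)
Lemma wsp_unique nu nu' v : wsp nu v -> wsp nu' v -> v <> 0 -> nu = nu'.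
Proof.
move=> vnu vnu' v0; apply/eqP; apply: contra_notT v0 => neq.
pose f (m : weight g) : V := if m == nu then v else - v.
have neq' : (nu' == nu) = false by rewrite eq_sym; exact: negbTE.
have := @wsp_direct _ _ _ _ _ V [:: nu; nu'] f; rewrite /= inE neq.
move=> /(_ isT) H; have := H _ _ nu; rewrite /f eqxx; apply.
- move=> m; rewrite !inE => /orP[] /eqP->; rewrite ?eqxx ?neq' //.
  by rewrite -[- v]addr0 -scaleN1r; apply: wsp_lin => //; exact: wsp0.
- by rewrite !big_cons big_nil /f eqxx neq' addr0 subrr.
- by rewrite inE eqxx.
Qed.

Lemma Fop_iter_wt s nu v n :
  wsp nu v -> wsp (nu - sroot g s *+ n) (iter n (Fop V s) v).
Proof.
elim: n => [|n IHn] vnu; first by rewrite mulr0n subr0.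
by rewrite mulrSr opprD addrA; apply: Fop_wt; exact: IHn.
Qed.

(** Moving E past one more F adds the quantum integer of the weight p - 2(n+1) of F^(n+1) v, and
    [qint_mulS] collects the two terms. *)
Lemma Eop_iterF s nu (p : int) v n :
  wsp nu v -> nu (coroot g s) = p%:~R -> Eop V s v = 0 ->
  Eop V s (iter n.+1 (Fop V s) v) =
  (qint (d s) n.+1%:Z * qint (d s) (p - n%:Z)) *: iter n (Fop V s) v.
Proof.
case: (a_gcm) => a2 _ _.
move=> vnu nup Ev; elim: n => [|n IHn].
  have /= := @EF_rel _ _ _ _ _ V s s _ _ _ vnu nup;
    rewrite eqxx Ev linear0 subr0 => ->.
  suff -> : qint (d s) 1 = 1 by rewrite mul1r subr0.
  by rewrite /qint expr1z exprN1 divff // -[X in X - _]expr1z -exprN1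
    qpow_sub_neq0.
have nun : (nu - sroot g s *+ n.+1) (coroot g s) = (p - n.+1%:Z - n.+1%:Z)%:~R.
  rewrite weightBn nup a2 -rmorphMn -rmorphB /= -mulr_natr natz.
  by congr _%:~R; lia.
have /= := @EF_rel _ _ _ _ _ V s s _ _ _ (Fop_iter_wt s n.+1 vnu) nun;
  rewrite eqxx.
move/eqP; rewrite subr_eq => /eqP ->; rewrite IHn linearZ /= -scalerDl;
  congr (_ *: _).
have -> : p - n%:Z = p - n.+1%:Z + 1 by lia.
have -> : n.+2%:Z = n.+1%:Z + 1 by lia.
by rewrite qint_mulS // addrC.
Qed.

Lemma Eop_iter_iterF s nu (p : int) v n :
  wsp nu v -> nu (coroot g s) = p%:~R -> Eop V s v = 0 ->
  iter n (Eop V s) (iter n (Fop V s) v) =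
  (\prod_(i < n) (qint (d s) i.+1%:Z * qint (d s) (p - i%:Z))) *: v.
Proof.
move=> vnu nup Ev; elim: n => [|n IHn]; first by rewrite big_ord0 scale1r.
rewrite iterSr (Eop_iterF n vnu nup Ev) big_ord_recr /=.
have -> (c : Kq) (u : V) : iter n (Eop V s) (c *: u) = c *: iter n (Eop V s) u.
  by elim: n {IHn} => //= n ->; rewrite linearZ.
by rewrite IHn scalerA mulrC.
Qed.

Hypothesis V_int : integrable V.

Lemma prod_qint_neq0 s (p : int) n : (forall i, (i < n)%N -> p != i%:Z) ->
  \prod_(i < n) (qint (d s) i.+1%:Z * qint (d s) (p - i%:Z)) != 0.
Proof.
move=> H; apply/prodf_neq0 => i _.
by rewrite mulf_neq0 // qint_neq0 // subr_eq0 H.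
Qed.

(** For negative p no factor [p - i] vanishes, so E^n F^n v is a nonzero multiple of v for every n,
    while integrability makes some F^n v zero. *)
Lemma lowest_eq0 s nu (p : int) v :
  wsp nu v -> nu (coroot g s) = p%:~R -> p < 0 -> Eop V s v = 0 -> v = 0.
Proof.
move=> vnu nup p0 Ev; case: (V_int s v) => _ [n Fn].
have := Eop_iter_iterF n vnu nup Ev; rewrite Fn.
have -> : iter n (Eop V s) 0 = 0 by elim: n {Fn} => //= n ->; rewrite linear0.
move/esym/eqP; rewrite scaler_eq0 (negPf (prod_qint_neq0 _ _)) //= => [|i _];
  first by move/eqP.
by apply: contraTneq p0 => ->.
Qed.

(* [E^N] isolates a multiple of the top [w_N]. If that multiple vanishes, the
   weight of [w_N] is some [i < N], and then [F^(i+1) w_N] is killed by [E]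
   although its weight is negative, so it is zero by integrability. *)
Lemma string_components_eq0 s nu N (w : nat -> V) :
  (forall n, wsp (nu + sroot g s *+ n) (w n)) ->
    (forall n, Eop V s (w n) = 0) ->
  \sum_(n < N) dpow d s (Fop V s) n (w n) = 0 ->
  forall n, (n < N)%N -> iter n (Fop V s) (w n) = 0.
Proof.
move=> w_wt w_E; elim: N => // N IHN; rewrite big_ord_recr /= => sum0.
have w_p n : w n <> 0 ->
  exists p : int, (nu + sroot g s *+ n) (coroot g s) = p%:~R.
  by move=> wn0; apply: wsp_integral (w_wt n) wn0.
have iterE0 n : iter n (Eop V s) 0 = 0 by elim: n => //= n ->; rewrite linear0.
have iterEZ n c v : iter n (Eop V s) (c *: v) = c *: iter n (Eop V s) v.
  by elim: n => //= n ->; rewrite linearZ.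
have iterED n u v : iter n (Eop V s) (u + v) = iter n (Eop V s) u + iter n (Eop
  V s) v.
  by elim: n => //= n ->; rewrite linearD.
(* E^k returns F^k w_k to a multiple of w_k, which one more E kills. The case w_k = 0 is separate
   because only nonzero vectors come with an integral weight. *)
have vanish k : (k < N)%N -> iter N (Eop V s) (iter k (Fop V s) (w k)) = 0.
  case: (eqVneq (w k) 0) => [-> _|/eqP/w_p[p pE] kN].
    have -> : iter k (Fop V s) 0 = 0 by elim: k => //= n ->; rewrite linear0.
    exact: iterE0.
  have -> : iter N (Eop V s) (iter k (Fop V s) (w k)) =
      iter (N - k.+1) (Eop V s) (iter k.+1 (Eop V s) (iter k (Fop V s) (w k))).
    by rewrite -iterD subnK.
  rewrite iterS (Eop_iter_iterF _ (w_wt k) pE) //.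
  by rewrite linearZ /= w_E scaler0 iterE0.
have topE : iter N (Eop V s) (iter N (Fop V s) (w N)) = 0.
  have := congr1 (iter N (Eop V s)) sum0; rewrite iterED iterE0 iterEZ.
  rewrite (_ : iter N _ _ = 0) ?add0r.
    by move/eqP; rewrite scaler_eq0 invr_eq0 (negPf (qfact_neq0 _ _)) //= =>
      /eqP.
  elim/big_rec: _ => [|i u _ uE]; first exact: iterE0.
  rewrite iterED uE addr0 iterEZ.
  by rewrite vanish // scaler0.
have top0 : iter N (Fop V s) (w N) = 0.
  case: (eqVneq (w N) 0) => [->|/eqP wN0].
    by elim: N {IHN sum0 topE vanish} => //= n ->; rewrite linear0.
  have [p pE] := w_p _ wN0.
  case: (pselect (exists2 i, (i < N)%N & p = i%:Z)) => [[i iN pi]|nex].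
    suff y0 : iter i.+1 (Fop V s) (w N) = 0.
      have -> : iter N (Fop V s) (w N) = iter (N - i.+1) (Fop V s) (iter i.+1
        (Fop V s) (w N)).
      by rewrite -iterD subnK.
    by rewrite y0; elim: (N - _)%N => //= n ->; rewrite linear0.
    (* F^(i+1) lowers the weight from i to i - 2(i+1) = - i - 2, and E kills the result because
       [p - i] = 0. *)
    apply: (lowest_eq0 (s := s) (p := - i%:Z - 2) (Fop_iter_wt s i.+1 (w_wt
      N))).
    - rewrite weightBn pE pi; case: a_gcm => -> _ _.
      by rewrite -rmorphMn -rmorphB /= -mulr_natr natz; congr _%:~R; lia.
    - by lia.
    - by rewrite (Eop_iterF _ (w_wt N) pE) // pi subrr qint0 mulr0 scale0r.
  case: wN0; move: topE; rewrite (Eop_iter_iterF N (w_wt N) pE) //.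
  move/eqP; rewrite scaler_eq0 (negPf (prod_qint_neq0 _ _)) //= =>
    [/eqP //|i iN].
  by apply/eqP => pi; apply: nex; exists i.
move: sum0; rewrite /dpow top0 scaler0 addr0 => /IHN H n.
by rewrite ltnS leq_eqVlt => /orP[/eqP->|/H].
Qed.

Lemma kashiwara_f_wt s v w : kashiwara_f s v w -> v <> 0 ->
  exists nu, wsp nu v /\ wsp (nu - sroot g s) w.
Proof.
case=> nu [N [u [u_wt _ -> ->]]] _; exists nu.
have sumP m (f : 'I_N -> V) : (forall n, wsp m (f n)) ->
  wsp m (\sum_(n < N) f n).
  move=> H; elim/big_rec: _ => [|i x _ xm]; first exact: wsp0.
  by rewrite -[f i]scale1r; exact: wsp_lin.
have powP n k : wsp (nu + sroot g s *+ n - sroot g s *+ k) (dpow d s (Fop V s)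
  k (u n)).
  by rewrite /dpow -[_ *: _]addr0; apply: wsp_lin;
    [exact: Fop_iter_wt | exact: wsp0].
split; apply: sumP => n; have := powP n.
  by move/(_ n); rewrite addrK.
by move/(_ n.+1); rewrite mulrSr opprD addrA addrK.
Qed.

(** [kashiwara_f] allows any string decomposition of its argument. In a decomposition of 0 every F^n
    w_n vanishes, hence so does every F^(n+1) w_n. *)
Lemma kashiwara_f0 s w : kashiwara_f s 0 w -> w = 0.
Proof.
case=> nu [N [u [u_wt u_E /esym u0 ->]]].
have H := string_components_eq0 u_wt u_E u0.
by apply: big1 => n _; rewrite /dpow /= H // linear0 scaler0.
Qed.

(** Since f~_s maps only 0 to 0 among the zero inputs, a string ending at a nonzero vector stays
    nonzero throughout, and each step lowers its weight by a simple root. The second clause gives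
    multiplicity one: weight [lam] is reached only by the empty string. *)
Lemma kstring_wt lam u v : highest_weight_vector lam u -> kstring u v ->
  v <> 0 ->
  exists c : Delta -> nat,
    wsp (lam - \sum_i sroot g i *+ c i) v /\ ((forall i, c i = 0%N) -> v = u).
Proof.
case=> u0 u_wt _; elim=> [_|s x w _ IH xw w0].
  by exists (fun _ => 0%N); split=> //; rewrite big1 ?subr0.
have x0 : x <> 0 by move=> x0; apply: w0; rewrite x0 in xw;
  exact: kashiwara_f0 xw.
have [c [x_wt _]] := IH x0; have [nu [x_nu w_nu]] := kashiwara_f_wt xw x0.
exists (fun i => c i + (i == s))%N; split; last by move=> /(_ s);
  rewrite eqxx addn1.
rewrite (wsp_unique x_nu x_wt x0) in w_nu; congr (wsp _ w): w_nu.
rewrite -addrA -opprD; congr (_ - _).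
under [in RHS]eq_bigr do rewrite mulrnDr; rewrite big_split /=; congr (_ + _).
by rewrite (bigD1 s) //= eqxx big1 ?addr0 // => i /negPf ->.
Qed.

End QuantumModule.

(** * Crystals of irreducible modules *)

Section CrystalSupport.
Variables (Delta : finType) (a : Delta -> Delta -> int) (d : Delta -> nat).
Hypotheses (a_gcm : gcm a) (d_gt0 : forall s, (0 < d s)%N).
Variables (R : realType) (g : realization a R).

Lemma sroot_sum_inj (b c : Delta -> nat) :
  \sum_i sroot g i *+ b i = \sum_i sroot g i *+ c i -> b =1 c.
Proof.
move=> /eqP; rewrite -subr_eq0 -sumrB => /eqP E.
have /freeP H : free [tuple of [seq sroot g s | s <- enum Delta]]
  by exact: sroot_free.
pose k (i : 'I_(#|Delta|)) : R[i] := (b (enum_val i))%:R - (c (enum_val i))%:R.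
have k0 : forall i, k i = 0.
  apply: H; rewrite -[RHS]E (reindex _ (onW_bij _ (enum_val_bij Delta))) /=.
  apply: eq_bigr => i _; rewrite (nth_map (enum_val i)) -?cardE //.
  by rewrite -enum_val_nth /k scalerBl !scaler_nat.
move=> s; have := k0 (enum_rank s); rewrite /k enum_rankK => /eqP.
by rewrite subr_eq0 eqr_nat => /eqP.
Qed.

(** Representatives are nonzero because 0 lies in q L, so the weights of strings pass to the
    crystal. In weight [lam] the representative must be [u], and elements with the same
    representative coincide. *)
Lemma crystal_of_irreducibleP (lam : weight g) (B : crystal g) :
  crystal_of_irreducible d lam B ->
  (forall x : B, exists c : Delta ->
    nat, wt x = lam - \sum_i sroot g i *+ c i) /\
  (forall x y : B, wt x = lam -> wt y = lam -> x = y).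
Proof.
case=> V [u [rep [[V_int _ u_hw] [rep_str rep_inj _ rep_wt _]]]].
have q0 : qklattice u 0.
  exists 0; last by rewrite scaler0.
  by exists 0%N, (fun=> 0), (fun=> 0); split=> [[]|[]|] //; rewrite big_ord0.
have rep0 x : rep x <> 0 by case: (rep_str x) => _ + E; rewrite E; exact.
have H x : exists c : Delta -> nat, wt x = lam - \sum_i sroot g i *+ c i /\
    ((forall i, c i = 0%N) -> rep x = u).
  case: (rep_str x) => x_str _.
  have [c [x_wt xu]] := kstring_wt a_gcm d_gt0 V_int u_hw x_str (rep0 x).
  by exists c; split=> //; exact: wsp_unique (rep_wt x) x_wt (rep0 x).
split=> [x|]; first by case: (H x) => c [xE _]; exists c.
have repu x : wt x = lam -> rep x = u.
  move=> xE; have [c [wtE cu]] := H x; apply: cu.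
  suff : c =1 (fun=> 0%N) by [].
  apply: sroot_sum_inj; rewrite [RHS]big1 ?mulr0n //.
  by apply: oppr_inj; rewrite oppr0; apply: (@addrI _ lam);
    rewrite addr0 -wtE xE.
move=> x y /repu xE /repu yE; apply: rep_inj.
by rewrite xE yE subrr.
Qed.

End CrystalSupport.

(** * Words in a crystal with a single highest weight element *)

Section CrystalWords.
Variables (Delta : finType) (a : Delta -> Delta -> int).
Hypothesis a_gcm : gcm a.
Variables (R : realType) (g : realization a R) (lam : weight g) (k : Delta).
Hypothesis lamP : forall s, lam (coroot g s) = (k == s)%:R.
Variable B : crystal g.
Hypothesis B_support :
  forall x : B, exists c : Delta -> nat, wt x = lam - \sum_i sroot g i *+ c i.
Hypothesis B_highest : forall x y : B, wt x = lam -> wt y = lam -> x = y.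
Implicit Types (x y z : B) (s : Delta) (S : {set Delta}) (w : seq Delta).

Lemma wti_seq x w s : wt x = lam - \sum_(i <- w) sroot g i ->
  wti s x = (k == s)%:Z - \sum_(i <- w) a s i.
Proof.
move=> xE; apply: (@intr_inj R[i]); rewrite -wtiP xE add_lfunE opp_lfunE lamP.
rewrite sum_lfunE rmorphB /= rmorph_sum /=; congr (_ - _).
by apply: eq_bigr => i _; rewrite sroot_coroot.
Qed.

Lemma wti_set x S s : wt x = lam - \sum_(i in S) sroot g i ->
  wti s x = (k == s)%:Z - \sum_(i in S) a s i.
Proof.
rewrite -[X in _ - X](big_enum _ _ S (sroot g)) => /wti_seq ->.
by rewrite big_enum.
Qed.

Lemma iter_ecr_wt s n x z : iter n (obind (ecr s)) (Some x) = Some z ->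
  wt z = wt x + sroot g s *+ n.
Proof.
elim: n z => [|n IHn] z /=; first by case=> ->; rewrite addr0.
case: (iter n _ _) IHn => //= y IHn /ecrP/fcr_wt yE.
by rewrite mulrSr addrA -(IHn y erefl) yE subrK.
Qed.

(** Each e_s adds one alpha_s to the weight, which must stay below [lam]. By independence of the
    simple roots, this happens at most as often as alpha_s was subtracted. *)
Lemma eps_le x S s : wt x = lam - \sum_(i in S) sroot g i ->
  (eps s x <= (s \in S))%N.
Proof.
move=> xE; have := (epsP s x (eps s x)).2 (leqnn _).
case zE: (iter _ _ _) => [z|] // _; have := iter_ecr_wt zE.
have [c ->] := B_support z; rewrite xE -addrA => /addrI E.
have : (fun i => c i + (i == s) * eps s x)%N =1 (fun i => (i \in S) : nat).
  apply: (@sroot_sum_inj _ _ _ g); transitivity (\sum_(i in S) sroot g i).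
    under eq_bigr do rewrite mulrnDr; rewrite big_split /=.
    rewrite [X in _ + X](bigD1 s) //= eqxx mul1n [X in _ + (_ + X)]big1 ?addr0.
      by rewrite -[X in X + _]opprK E opprD opprK subrK.
    by move=> i /negPf ->.
  by rewrite [LHS]big_mkcond; apply: eq_bigr => i _; case: (i \in S).
by move/(_ s); rewrite eqxx mul1n => <-; rewrite leq_addl.
Qed.

Lemma fcr_defined x s : 0 < wti s x -> exists y, fcr s x = Some y.
Proof.
move=> x_gt0; have : (1 <= phi s x)%N.
  by have := phi_eps s x; lia.
by move/phiP => /=; case: (fcr s x) => [y|] // _; exists y.
Qed.

Lemma ecr_defined x s : wti s x < 0 -> exists y, ecr s x = Some y.
Proof.
move=> x_lt0; have : (1 <= eps s x)%N.
  by have := phi_eps s x; lia.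
by move/epsP => /=; case: (ecr s x) => [y|] // _; exists y.
Qed.

(* Starting from weight [lam] and reading [w] from right to left, the weight
   pairs to 1 with the coroot of each letter when that letter is reached. *)
Fixpoint unit_steps w : bool :=
  if w is s :: w' then ((k == s)%:Z - \sum_(i <- w') a s i == 1) && unit_steps
    w'
  else true.

(* At each step the weight drops from 1 to -1, so [e_s] is defined on every
   element of the new weight and leads back to the previous one. *)
Lemma fword_unit_steps w x0 : unit_steps w -> wt x0 = lam -> exists y,
  [/\ fword (@fcr _ _ _ _ B) w x0 = Some y, wt y = lam - \sum_(i <- w) sroot g i
    & forall z, wt z = wt y -> z = y].
Proof.
move=> + x0E; elim: w => [_|s w IHw /= /andP[/eqP s1 /IHw[y [yE y_wt y_uniq]]]].
  exists x0; split=> //; first by rewrite big_nil subr0.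
  by move=> z zE; apply: B_highest => //; rewrite zE.
have y_s : wti s y = 1 by rewrite (wti_seq s y_wt).
have [y' y'E] : exists y', fcr s y = Some y' by apply: fcr_defined; rewrite y_s.
have y'_wt : wt y' = lam - \sum_(i <- s :: w) sroot g i.
  by rewrite (fcr_wt y'E) y_wt big_cons opprD addrAC addrA.
exists y'; rewrite yE /=; split=> // z zE.
have z_s : wti s z = -1.
  rewrite y'_wt in zE; rewrite (wti_seq s zE) big_cons opprD addrCA s1.
  by case: a_gcm => -> _ _.
have [z' z'E] : exists z', ecr s z = Some z' by apply: ecr_defined; rewrite z_s.
have /ecrP fz' := z'E.
have := y_uniq z'; rewrite -(addrK (- sroot g s) (wt z')) -(fcr_wt fz') zE
  (fcr_wt y'E).
rewrite addrK => /(_ erefl) z'y; move: fz'; rewrite z'y y'E; by case.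
Qed.

(* If [eps_k x] were positive, [e_k x] would have weight -2 along
   [alpha_j^vee], hence [alpha_j] would occur twice below the highest weight. *)
Lemma eps_top_eq0 x S j : wt x = lam - \sum_(i in S) sroot g i ->
  k \in S -> j \in S -> j != k -> (forall i, i \in S -> i != j -> i != k ->
    a j i = 0) ->
  eps k x = 0%N.
Proof.
move=> xE kS jS jk a0; apply/eqP; rewrite -leqn0 leqNgt; apply/negP => /epsP /=.
case zE: (ecr k x) => [z|] // _;
  have z_wt : wt z = lam - \sum_(i in S :\ k) sroot g i.
  move/ecrP/fcr_wt: zE; rewrite xE (big_setD1 k kS) /= opprD addrCA [LHS]addrC.
  by move/addIr.
have := eps_le j z_wt; have := phi_eps j z;
  rewrite (wti_set j z_wt) (negPf (_ : k != j)) ?(eq_sym k) //.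
have jSk : j \in S :\ k by rewrite !inE jk.
rewrite (big_setD1 j jSk) big1 /=; last first.
  by move=> i; rewrite !inE => /and3P[ij ik iS]; exact: a0.
case: a_gcm => -> _ _; rewrite jSk => /=; lia.
Qed.

End CrystalWords.

(** * Position of the action on a tensor product *)

Section TensorSteps.
Variables (Delta : finType) (a : Delta -> Delta -> int).
Variables (R : realType) (g : realization a R).
Variables (num : Delta -> nat) (B : Delta -> crystal g).
Hypothesis num_inj : injective num.
Variables (s : Delta) (x : tensor B).
Implicit Types (p j h : Delta).

Local Notation W h := (wti s (x h)).
Local Notation between j p := [set h | (num j < num h <= num p)%N].

(** Writing phi as eps + wt moves the weight of the j-th factor into the partial sum; two positions
    then compare through eps and the weights between them. *)
Lemma tensor_phiE j : tensor_phi num s x j =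
  (eps s (x j))%:Z + \sum_(h | (num h <= num j)%N) W h.
Proof.
rewrite /tensor_phi phi_eps [X in _ = _ + X](bigD1 j) //= addrA;
  congr (_ + _); apply: eq_bigl => h.
by rewrite ltn_neqAle andbC; congr (_ && ~~ _); apply/eqP/eqP => [/num_inj|->].
Qed.

Lemma sum_between j p : (num j <= num p)%N ->
  \sum_(h | (num h <= num p)%N) W h =
  \sum_(h | (num h <= num j)%N) W h + \sum_(h in between j p) W h.
Proof.
move=> jp; rewrite (bigID (fun h => (num h <= num j)%N)) /=; congr (_ + _);
  apply: eq_bigl => h.
  by rewrite andb_idl // => /leq_trans; apply.
by rewrite inE -ltnNge andbC.
Qed.

Lemma sum_sub_le (A C : {set Delta}) : A \subset C ->
  (forall h, h \in C -> h \notin A -> 0 <= W h) ->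
  \sum_(h in A) W h <= \sum_(h in C) W h.
Proof.
move=> sAC H; rewrite [X in _ <= X](bigID (mem A)) /=.
rewrite [X in X + _](eq_bigl (mem A)); last first.
  by move=> h /=; rewrite andb_idl //; exact: subsetP.
by rewrite lerDl sumr_ge0 // => h /andP[]; exact: H.
Qed.

Lemma term_le_sum p (C : {set Delta}) : p \in C ->
  (forall h, h \in C -> 0 <= W h) -> W p <= \sum_(h in C) W h.
Proof.
move=> pC W0; rewrite (big_setD1 p pC) /= lerDl sumr_ge0 // => h.
by rewrite inE => /andP[_ /W0].
Qed.

(** After cancelling the common partial sum, the hypotheses say that [p] beats earlier positions
    strictly and later ones weakly, so it is the first maximum. *)
Lemma tensor_f_at p : 0 < W p ->
  (forall j, (num j < num p)%N ->
     (eps s (x j))%:Z < (eps s (x p))%:Z + \sum_(h in between j p) W h) ->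
  (forall j, (num p < num j)%N ->
     (eps s (x j))%:Z + \sum_(h in between p j) W h <= (eps s (x p))%:Z) ->
  exists y, fcr s (x p) = Some y /\ tensor_f num s x = Some (dfwith x y).
Proof.
move=> Wp before after.
have lt j : (num j < num p)%N -> tensor_phi num s x j < tensor_phi num s x p.
  move=> jp; rewrite !tensor_phiE (sum_between (ltnW jp)).
  by have := before j jp; lia.
have le j : tensor_phi num s x j <= tensor_phi num s x p.
  case: (ltngtP (num j) (num p)) => [/lt/ltW //|pj|/num_inj -> //].
  rewrite !tensor_phiE (sum_between (ltnW pj)).
  by have := after j pj; lia.
have [y yE] := fcr_defined Wp; exists y; split=> //.
rewrite /tensor_f /tensor_pos;
  case: pickP => [q /andP[/forallP q1 /forallP q2]|/(_ p)]; last first.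
  move/negP; case; apply/andP; split; apply/forallP => h //.
  by apply/implyP; exact: lt.
suff -> : q = p by rewrite yE.
case: (ltngtP (num q) (num p)) => [/lt|pq|/num_inj //];
  first by rewrite ltNge q1.
by have := implyP (q2 p) pq; rewrite ltNge le.
Qed.

(** The compared function is a non-decreasing partial sum whose last increase is at [p]. *)
Lemma tensor_f_nonneg p : 0 < W p -> (forall h, eps s (x h) = 0%N) ->
  (forall h, 0 <= W h) -> (forall h, (num p < num h)%N -> W h = 0) ->
  exists y, fcr s (x p) = Some y /\ tensor_f num s x = Some (dfwith x y).
Proof.
move=> Wp eps0 W0 Wafter; apply: tensor_f_at => // j jp; rewrite !eps0 add0r.
  by apply: lt_le_trans Wp _; apply: term_le_sum; rewrite // inE jp leqnn.
by rewrite big1 // => h; rewrite inE => /andP[/Wafter].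
Qed.

(** The partial sum may drop by one at [d], where eps may also be one. The two increments after [d]
    outweigh both, so the last increase still gives the first maximum. *)
Lemma tensor_f_two p d h1 h2 : (num d < num p)%N -> 0 < W p ->
  (forall h, h != d -> eps s (x h) = 0%N) -> (eps s (x d) <= 1)%N ->
  (forall h, h != d -> 0 <= W h) -> -1 <= W d ->
  (forall h, (num p < num h)%N -> W h = 0) ->
  h1 != h2 -> (num d < num h1)%N -> (num d < num h2)%N -> 0 < W h1 ->
    0 < W h2 ->
  exists y, fcr s (x p) = Some y /\ tensor_f num s x = Some (dfwith x y).
Proof.
move=> dp Wp eps0 epsd W0 Wd Wafter h12 dh1 dh2 Wh1 Wh2.
have neq j : (num d < num j)%N -> j != d by apply: contraTneq => ->;
  rewrite ltnn.
have le_p h : 0 < W h -> (num h <= num p)%N.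
  by move=> Wh; rewrite leqNgt; apply: contraTN Wh => /Wafter ->.
have eps_p := eps0 p (neq _ dp).
apply: tensor_f_at => // j jp; rewrite eps_p ?add0r; last first.
  rewrite eps0 ?neq //; last exact: ltn_trans jp.
  by rewrite add0r big1 // => h; rewrite inE => /andP[/Wafter].
have two (A : {set Delta}) : h1 \in A -> h2 \in A -> d \notin A ->
  2 <= \sum_(h in A) W h.
  move=> h1A h2A dA; apply: (@le_trans _ _ (\sum_(h in [set h1; h2]) W h)).
    by rewrite big_setU1 ?inE //= big_set1; lia.
  apply: sum_sub_le => [|h hA _].
    by apply/subsetP => h; rewrite !inE => /orP[] /eqP ->.
  by apply: W0; apply: contraNneq dA => <-.
case: (ltngtP (num j) (num d)) => [jd|dj|/num_inj ->].
- rewrite eps0; last by apply: contraTneq jd => ->; rewrite ltnn.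
  have dB : d \in between j p by rewrite inE jd ltnW.
  rewrite (big_setD1 d dB) /=.
  suff H : 2 <= \sum_(h in between j p :\ d) W h
    by exact: lt_le_trans (lerD Wd H).
  by apply: two; rewrite !inE ?eqxx // ?neq // le_p // andbT (ltn_trans jd).
- rewrite eps0 ?neq //; apply: lt_le_trans Wp _.
  apply: term_le_sum => [|h]; first by rewrite inE jp leqnn.
  by rewrite inE => /andP[jh _]; apply: W0; apply: neq; exact: ltn_trans jh.
suff : 2 <= \sum_(h in between d p) W h by lia.
by apply: two; rewrite !inE ?ltnn // le_p // ?dh1 ?dh2.
Qed.

(** The partial sum rises by one at [p], falls by one at [d], and afterwards rises by at most one in
    total. The value at [p] is thus never exceeded. *)
Lemma tensor_f_one p d : (num p < num d)%N -> W p = 1 ->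
  (forall h, h != d -> eps s (x h) = 0%N) -> (eps s (x d) <= 1)%N ->
  (forall h, (num h < num d)%N -> h != p -> W h = 0) -> W d = -1 ->
  (forall h, (num d < num h)%N -> 0 <= W h) ->
  \sum_(h in [set h | (num d < num h)%N]) W h <= 1 ->
  exists y, fcr s (x p) = Some y /\ tensor_f num s x = Some (dfwith x y).
Proof.
move=> pd Wp eps0 epsd W0 Wd Wgt sum1.
have neq j : (num j < num d)%N -> j != d by apply: contraTneq => ->;
  rewrite ltnn.
apply: tensor_f_at => [|j jp|j pj]; rewrite ?Wp // (eps0 p) ?neq // ?add0r.
  have jd := ltn_trans jp pd; rewrite eps0 ?neq //.
  have pB : p \in between j p by rewrite inE jp leqnn.
  rewrite (big_setD1 p pB) /= Wp big1 ?addr0 // => h.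
  rewrite !inE => /and3P[hp _ hle]; apply: W0 => //; exact: leq_ltn_trans pd.
have pd_sum : \sum_(h in between p d) W h = -1.
  have dB : d \in between p d by rewrite inE pd leqnn.
  rewrite (big_setD1 d dB) /= Wd big1 ?addr0 // => h; rewrite !inE.
  case/and3P=> hd ph hle; apply: W0; last by apply: contraTneq ph => ->;
    rewrite ltnn.
  by rewrite ltn_neqAle hle andbT; apply: contraNneq hd => /num_inj ->.
case: (ltngtP (num j) (num d)) => [jd|dj|/num_inj ->].
- rewrite eps0 ?neq // add0r big1 // => h; rewrite inE => /andP[ph hj].
  by apply: W0; [exact: leq_ltn_trans jd | apply: contraTneq ph => ->;
    rewrite ltnn].
- rewrite eps0; last by apply: contraTneq dj => ->; rewrite ltnn.
  have pj_sum : \sum_(h in between p j) W h =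
      \sum_(h in between p d) W h + \sum_(h in between d j) W h.
    apply: (@addrI _ (\sum_(h | (num h <= num p)%N) W h)).
    by rewrite -sum_between ?(ltnW pj) // addrA -!sum_between // ltnW.
  rewrite add0r pj_sum pd_sum addrC subr_le0; apply: le_trans sum1.
  apply: sum_sub_le => [|h]; last by rewrite inE => /Wgt.
  by apply/subsetP => h; rewrite !inE => /andP[].
by rewrite pd_sum subr_le0 lez_nat.
Qed.

End TensorSteps.

(** * Rooted forests *)

(** Where two paths diverge, they leave [x] through distinct neighbours [y] and [z]. Both
    continuations avoid [x] and meet at the common end, so [y] and [z] are joined away from [x],
    which closes a cycle of length at least 3. *)
Lemma acyclic_path_unique (T : finType) (e : rel T) (x : T) (p q : seq T) :
  symmetric e -> (forall c, ucycle e c -> size c <= 2)%N ->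
  path e x p -> path e x q -> uniq (x :: p) -> uniq (x :: q) ->
  last x p = last x q -> p = q.
Proof.
move=> e_sym e_acyc.
elim: p x q => [|y p IHp] x [|z q] //=.
- by move=> _ _ _ /andP[xNq _] xE; rewrite xE mem_last in xNq.
- by move=> _ _ /andP[xNp _] _ xE; rewrite -xE mem_last in xNp.
case/andP=> xy yp /andP[xz zq] /andP[xNp up] /andP[xNq uq] lastE.
case: (eqVneq y z) => [yz|yDz].
  by move: zq uq lastE; rewrite -yz => zq uq lastE; rewrite (IHp y q).
(* This is the graph with the vertex [x] removed. *)
pose e' := [rel u v | [&& e u v, u != x & v != x]].
have e'_sym : connect_sym e'.
  by apply: sym_connect_sym => u v /=; rewrite e_sym; case: (e v u) => //=;
    rewrite andbC.
have avoid u s : path e u s -> x \notin u :: s -> path e' u s.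
  elim: s u => //= v s IHs u /andP[uv vs]; rewrite inE negb_or => /andP[xu xs].
  rewrite uv (eq_sym u) xu IHs // andbT /=.
  by move: xs; rewrite inE negb_or eq_sym => /andP[].
have : connect e' y z.
  apply: (@connect_trans _ _ (last y p)); first by apply/connectP; exists p;
    rewrite ?avoid.
  by rewrite e'_sym lastE; apply/connectP; exists q; rewrite ?avoid.
case/connectP=> s0 /shortenP[s ys us _] zE.
have notin u t : path e' u t -> x != u -> x \notin u :: t.
  elim: t u => [|v t IHt] u /=; first by rewrite inE.
  by case/andP=> /and3P[_ _ vx] vt xu; rewrite inE negb_or xu IHt // eq_sym.
have xNs : x \notin y :: s.
  by apply: notin => //; move: xNp; rewrite inE negb_or => /andP[].
have es : path e y s by apply: sub_path ys => u v /= /and3P[].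
suff /e_acyc /= : ucycle e (x :: y :: s).
  by case: (s) zE => //= yE; rewrite yE eqxx in yDz.
by rewrite /ucycle /= rcons_path xy es -zE e_sym xz xNs.
Qed.

Section Forest.
Variables (Delta : finType) (a : Delta -> Delta -> int).
Variables (I D rts : {set Delta}) (num : Delta -> nat).
Hypotheses (a_gcm : gcm a) (I_acyclic : acyclic a I) (D_sub_I : D \subset I).
Hypotheses (rtsP : root_choice a I rts) (num_adapted : adapted a I D rts num).
Local Open Scope nat_scope.

Local Notation adj := (adj a I).
Local Notation covers := (covers a I rts).
Local Notation rootpath := (rootpath a I rts).
Local Notation height := (height a I rts).
Local Notation C_I := (C_I a I rts).
Local Notation C_D := (C_D a I D rts).
Local Notation leaf := (leaf a I D rts).
Local Notation DL := (DL a I D rts).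
Local Notation DL_at := (DL_at a I D rts).
Local Notation Dstar := (Dstar a I D rts).
Local Notation dep := (dep a I D rts).
Local Notation coversD := (coversD a I D rts).
Local Notation sigma_rec := (sigma_rec a I D rts num).
Local Notation sigma := (sigma a I D rts num).
Local Notation mu := (mu a I D rts num).
Local Notation largest := (largest num).

Lemma num_inj : injective num. Proof. by case: num_adapted. Qed.

Lemma adj_sym : symmetric adj.
Proof.
case: a_gcm => _ _ a0 x y; rewrite /Defs.adj /= (eq_sym x) andbCA;
  congr [&& _, _, _ & _].
by apply/idP/idP; apply: contraNN => /eqP/a0 ->.
Qed.

Lemma rootpath_in x p : rootpath x p -> x \in I.
Proof.
case: p => [|y p] /and3P[].
  by move=> _ _ /= xr; case: rtsP => /subsetP + _; exact.
by case/andP=> /and4P[].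
Qed.

Lemma rootpath_ex x : x \in I -> exists p, rootpath x p.
Proof.
case: rtsP => _ H /H[r [[rr /connectP[p0 /shortenP[p xp up _] rE]] _]].
by exists p; rewrite /Defs.rootpath xp up -rE rr.
Qed.

Lemma rootpath_unique x p q : rootpath x p -> rootpath x q -> p = q.
Proof.
move=> xp xq; have xI := rootpath_in xp.
case: rtsP => _ /(_ x xI)[r [_ r_uniq]].
case/and3P: xp xq => xp up lp /and3P[xq uq lq].
apply: (acyclic_path_unique adj_sym I_acyclic xp xq up uq).
by rewrite -(r_uniq (last x p)) ?(r_uniq (last x q)) //; split=> //;
  apply/connectP; [exists q | exists p].
Qed.

Lemma rootpath_size x p : rootpath x p -> size p < #|Delta|.
Proof. by case/and3P=> _ /card_uniqP /= <- _; exact: max_card. Qed.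

Lemma heightE x p : rootpath x p -> height x = size p.
Proof.
move=> xp; rewrite /Defs.height (big_pred1 (Ordinal (rootpath_size xp))) //= =>
  n.
apply/asboolP/eqP => [[q xq qn]|->]; last by exists p.
by apply: val_inj; rewrite /= -qn (rootpath_unique xp xq).
Qed.

Lemma covers_rootpath x y :
  covers x y -> exists2 p, rootpath x (y :: p) & rootpath y p.
Proof.
move/asboolP=> [p xp]; exists p => //.
by case/and3P: xp => /andP[_ yp] /andP[_ up] lp; apply/and3P; split.
Qed.

Lemma covers_adj x y : covers x y -> adj x y.
Proof. by case/covers_rootpath=> p /and3P[/andP[]]. Qed.

Lemma covers_inl x y : covers x y -> x \in I.
Proof. by move/covers_adj/and4P=> []. Qed.

Lemma covers_inr x y : covers x y -> y \in I.
Proof. by move/covers_adj/and4P=> []. Qed.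

Lemma covers_height x y : covers x y -> height x = (height y).+1.
Proof. by case/covers_rootpath=> p xp yp;
  rewrite (heightE xp) (heightE yp). Qed.

Lemma covers_num x y : covers x y -> num y < num x.
Proof.
move=> xy; case: num_adapted => _ _ _ H _; apply: H.
- exact: covers_inr xy.
- exact: covers_inl xy.
- by rewrite (covers_height xy).
Qed.

Lemma covers_neq x y : covers x y -> x != y.
Proof. by move/covers_num; apply: contraTneq => ->; rewrite ltnn. Qed.

Lemma covers_fun x y z : covers x y -> covers x z -> y = z.
Proof.
case/covers_rootpath=> p xp _ /covers_rootpath[q xq _].
by case: (rootpath_unique xp xq).
Qed.

(** Take the root path of [y]. If it avoids [x], prefixing [x] gives the root path of [x]; otherwise
    [y] followed by the part from [x] on is a root path of [y]. *)
Lemma adj_covers x y : adj x y = covers x y || covers y x.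
Proof.
apply/idP/idP; last first.
  by case/orP=> /covers_adj //; rewrite adj_sym.
move=> xy; have [q yq] : exists q, rootpath y q.
  by apply: rootpath_ex; case/and4P: xy.
case: (boolP (x \in y :: q)) => [|xNq]; last first.
  apply/orP; left; apply/asboolP; exists q.
  by case/and3P: yq => yq uq lq; apply/and3P; split => //; rewrite /= ?xNq ?xy.
rewrite inE => /orP[/eqP xE|].
  by move: xy; rewrite xE => /and4P[_ _]; rewrite eqxx.
move/path.splitPr=> E; case: E yq => q1 q2 /and3P[yq uq lq].
apply/orP; right; apply/asboolP; exists q2.
move: yq uq lq; rewrite cat_path last_cat /= cat_uniq.
case/and3P=> _ _ xq2 /andP[]; rewrite mem_cat negb_or => /andP[_ yN].
case/and3P=> _ _ uxq2 lq; apply/and3P; split => //.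
  by rewrite /= adj_sym xy.
by apply/andP; split.
Qed.

Lemma adj_siblings x y z : covers x z -> covers y z -> ~~ adj x y.
Proof.
move=> xz yz; rewrite adj_covers; apply/negP => /orP[xy|yx].
  by have := covers_neq yz; rewrite (covers_fun xy xz) eqxx.
by have := covers_neq xz; rewrite (covers_fun yx yz) eqxx.
Qed.

Lemma connect_covers_num x y : connect covers x y -> num y <= num x.
Proof.
case/connectP=> p; elim: p x => [|z p IHp] x /=; first by move=> _ ->.
by case/andP=> /covers_num xz zp /(IHp _ zp) /leq_trans; apply; exact: ltnW.
Qed.

Lemma connect_covers_chain x y z :
  connect covers x y -> connect covers x z ->
  connect covers y z \/ connect covers z y.
Proof.
case/connectP=> p xp -> {y}; elim: p x z xp => [|y p IHp] x z /=; first by left.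
case/andP=> xy yp /connectP[[|v q] /=].
  by move=> _ ->; right; apply/connectP; exists (y :: p); rewrite //= xy.
case/andP=> xv vq ->; apply: IHp => //.
by rewrite (covers_fun xy xv); apply/connectP; exists q.
Qed.

(** Both children lie on the chain from [x] to its root. If they differed, the path from one to the
    other would pass through [d] and then have to climb again, although numbers fall along it. *)
Lemma child_on_rootpath_unique x c c' d :
  covers c d -> covers c' d -> connect covers x c -> connect covers x c' ->
  c = c'.
Proof.
have aux u v w : covers u w -> covers v w -> connect covers u v -> u = v.
  move=> uw vw /connectP[[|z p] /=]; first by move=> _ ->.
  case/andP=> uz zp vE; rewrite (covers_fun uz uw) in zp vE.
  have : connect covers w v by apply/connectP; exists p.
  by move/connect_covers_num; rewrite leqNgt (covers_num vw).
move=> cd c'd xc xc'.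
case: (connect_covers_chain xc xc') => [|] H; first exact: aux cd c'd H.
by apply/esym/(aux _ _ _ c'd cd H).
Qed.

(** * The functions sigma and mu *)

Lemma in_C_I x d : (x \in C_I d) = covers x d.
Proof. by rewrite inE; case: (boolP (covers x d)) => [/covers_inl ->|];
  rewrite ?andbF. Qed.

Lemma in_C_D x d : (x \in C_D d) = covers x d && (x \in D).
Proof. by rewrite inE in_C_I. Qed.

Lemma Dstar_D d : d \in Dstar -> d \in D.
Proof. by rewrite inE => /andP[]. Qed.

Lemma DL_leaf d : d \in DL -> leaf d.
Proof. by rewrite inE => /andP[]. Qed.

Lemma leaf_childN d x : leaf d -> covers x d -> x \notin D.
Proof.
case/andP=> _ /eqP C0 xd; apply/negP => xD.
by have := in_C_D x d; rewrite xd xD C0 inE.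
Qed.

Lemma coversD_intro x y : x \in D -> y \in D -> covers x y -> coversD x y.
Proof. by move=> xD yD xy; apply/and3P. Qed.

(** * Depth in [D] *)

Lemma coversD_path_height x p :
  path coversD x p -> height x = height (last x p) + size p.
Proof.
elim: p x => [|y p IHp] x /=; first by rewrite addn0.
by case/andP=> /and3P[_ _ /covers_height ->] /IHp ->; rewrite addnS.
Qed.

(** Height falls by one at each edge, so such a path is no longer than the root path of its start.
    The range of the maximum in [dep] therefore loses no path. *)
Lemma coversD_path_size l p : l \in D -> path coversD l p -> size p < #|Delta|.
Proof.
move=> /(subsetP D_sub_I)/rootpath_ex[q lq] /coversD_path_height.
rewrite (heightE lq) => E; apply: leq_ltn_trans (rootpath_size lq).
by rewrite E leq_addl.
Qed.

Lemma dep_ge l p : leaf l -> path coversD l p -> size p <= dep (last l p).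
Proof.
move=> ll lp; have lD : l \in D by case/andP: ll.
pose n := Ordinal (coversD_path_size lD lp).
by apply: (leq_bigmax_cond n); apply/asboolP; exists l, p.
Qed.

Lemma num_le s : num s <= #|Delta|.
Proof. by case: num_adapted => _ /(_ s)/andP[]. Qed.

(** Children have larger numbers and numbers are bounded, so induction from the children to their
    parent is well founded. *)
Lemma covers_ind (P : Delta -> Prop) :
  (forall d, (forall c, covers c d -> P c) -> P d) -> forall d, P d.
Proof.
move=> H d; have [n] := ubnP (#|Delta| - num d).
elim: n d => // n IHn d dn; apply: H => c cd; apply: IHn.
apply: leq_trans (dn : _ <= n); have := covers_num cd.
by move=> lt; rewrite ltn_sub2l // (leq_trans lt (num_le c)).
Qed.

Lemma leaf_below d : d \in D -> exists l p,
  [/\ leaf l, path coversD l p & last l p = d].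
Proof.
elim/covers_ind: d => d IH dD.
case: (boolP (leaf d)) => [ld|]; first by exists d, [::].
rewrite /Defs.leaf dD /= => /set0Pn[c]; rewrite in_C_D => /andP[cd cD].
have [l [p [ll lp pE]]] := IH c cd cD; exists l, (rcons p d).
by rewrite last_rcons rcons_path lp pE; split => //; exact: coversD_intro.
Qed.

Lemma dep_attained d : d \in D -> exists l p,
  [/\ leaf l, path coversD l p, last l p = d & size p = dep d].
Proof.
case/leaf_below=> l [p [ll lp pE]].
pose P := [pred n : 'I_#|Delta| | `[< exists l p,
  [/\ leaf l, path coversD l p, last l p = d & size p = n] >]].
have lD : l \in D by case/andP: ll.
have P0 : 0 < #|P|.
  apply/card_gt0P; exists (Ordinal (coversD_path_size lD lp)).
  by apply/asboolP; exists l, p.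
have [n /asboolP[l' [p' [? ? ? pn]]] E] := eq_bigmax_cond (@nat_of_ord _) P0.
by exists l', p'; split => //; rewrite pn; exact: esym E.
Qed.

Lemma dep_lt c d : c \in D -> d \in D -> covers c d -> dep c < dep d.
Proof.
move=> cD dD cd; have [l [p [ll lp pE <-]]] := dep_attained cD.
have := @dep_ge l (rcons p d) ll;
  rewrite rcons_path size_rcons last_rcons lp pE.
by apply; exact: coversD_intro.
Qed.

Lemma dep_pred d : d \in D -> 0 < dep d ->
  exists2 c, c \in C_D d & dep d <= (dep c).+1.
Proof.
move=> dD; have [l [p [ll lp pE <-]]] := dep_attained dD.
case/lastP: p lp pE => // p z; rewrite rcons_path last_rcons size_rcons.
case/andP=> lp /and3P[cD _ cz] zE _; exists (last l p).
  by rewrite in_C_D -zE cz cD.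
by rewrite ltnS; exact: dep_ge.
Qed.

Lemma dep_eq0 d : d \in D -> (dep d == 0) = leaf d.
Proof.
move=> dD; apply/idP/idP => [|ld].
  apply: contraTT; rewrite /Defs.leaf dD /= => /set0Pn[c].
  rewrite in_C_D => /andP[cd cD]; rewrite -lt0n.
  exact: leq_ltn_trans (dep_lt cD dD cd).
rewrite -leqn0 leqNgt; apply/negP => /(dep_pred dD)[c].
by rewrite in_C_D => /andP[/(leaf_childN ld)/negP].
Qed.

Lemma dep_eq1 d : d \in D -> ~~ leaf d -> C_D d \subset DL -> dep d = 1.
Proof.
move=> dD nl /subsetP sub; have := dep_eq0 dD.
rewrite (negPf nl) => /negbT; rewrite -lt0n => d0.
apply/eqP; rewrite eqn_leq d0 andbT.
have [c cC le] := dep_pred dD d0; apply: leq_trans le _; rewrite ltnS.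
have cD : c \in D by move: cC; rewrite in_C_D => /andP[].
by rewrite leqn0 dep_eq0 // DL_leaf // sub.
Qed.

(** * Orbits of partial maps and the recursion for sigma *)

Lemma iter_obind_None (T : Type) (f : T ->
  option T) q : iter q (obind f) None = None.
Proof. by elim: q => //= q ->. Qed.

(** Once an iterate is undefined all later ones are, so the defined exponents are exactly those up
    to [q]. *)
Lemma last_iterateE (sg : Delta -> option Delta) d m q :
  q <= #|Delta| -> iter q (obind sg) (Some d) = Some m -> sg m = None ->
  last_iterate sg d = Some m.
Proof.
move=> qD qE mN.
have defE q' : isSome (iter q' (obind sg) (Some d)) = (q' <= q).
  case: leqP => [le|lt].
    move: qE; rewrite -(subnK le) iterD.
    by case: (iter q' _ _) => //; rewrite iter_obind_None.
  by rewrite -(subnK lt) iterD iterS qE /= mN iter_obind_None.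
rewrite /last_iterate; under eq_bigl do rewrite defE.
suff -> : \max_(i < #|Delta|.+1 | i <= q) i = q by [].
apply/eqP; rewrite eqn_leq; apply/andP; split; first by apply/bigmax_leqP.
by apply: (leq_bigmax_cond (Ordinal (qD : q < #|Delta|.+1))) => /=.
Qed.

Lemma largestP (X : {set Delta}) : X != set0 -> exists m,
  [/\ largest X = Some m, m \in X & forall y, y \in X -> num y <= num m].
Proof.
case/set0Pn=> x xX; rewrite /Defs.largest;
  case: pickP => [m /andP[mX /forall_inP H]|H].
  by exists m.
case: (arg_maxnP num xX) => m mX /= maxm.
by have /negP[] := negbT (H m); apply/andP; split=> //;
  apply/forall_inP => y /maxm.
Qed.

Lemma largest_in (X : {set Delta}) m : largest X = Some m -> m \in X.
Proof. by rewrite /Defs.largest; case: pickP => // x /andP[xX _] [<-]. Qed.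

Lemma sigma_rec_covers n d c :
  sigma_rec n d = Some c -> d \in Dstar /\ covers c d.
Proof.
case: n => //= n; case: (boolP (d \in Dstar)) => //= dD; case: ifP => _.
  by move/largest_in; rewrite in_C_I.
case: ifP => _; first by move/largest_in; rewrite in_C_D => /andP[].
by case: pickP => // x /andP[+ _] [<-]; rewrite inE in_C_D => /andP[/andP[]].
Qed.

Lemma sigma_recN n d : d \notin Dstar -> sigma_rec n d = None.
Proof. by case: n => //= n ->. Qed.

Lemma sigma_rec_dep c d n : sigma_rec n d = Some c -> c \in Dstar ->
  dep c < dep d.
Proof. by case/sigma_rec_covers=> /Dstar_D dD cd /Dstar_D cD;
  exact: dep_lt. Qed.

(** An orbit either moves to smaller depth, where the maps agree, or leaves [Dstar], where both are
    undefined. *)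
Lemma eq_last_iterate (sg sg' : Delta -> option Delta) k :
  (forall d, dep d < k -> sg d = sg' d) ->
  (forall d c, sg' d = Some c -> c \in Dstar -> dep c < dep d) ->
  (forall d, d \notin Dstar -> sg d = None /\ sg' d = None) ->
  forall d, dep d < k -> last_iterate sg d = last_iterate sg' d.
Proof.
move=> E sg_dep sgN d dk.
suff Eiter q : iter q (obind sg) (Some d) = iter q (obind sg') (Some d).
  by rewrite /last_iterate Eiter; under eq_bigl do rewrite Eiter.
elim: q d dk => // q IHq d dk; rewrite !iterSr /= E //.
case dE: (sg' d) => [c|]; last by rewrite !iter_obind_None.
case: (boolP (c \in Dstar)) => [cD|/sgN[cN cN']].
  by apply: IHq; apply: ltn_trans (sg_dep _ _ dE cD) dk.
by case: q {IHq} => // q; rewrite !iterSr /= cN cN' !iter_obind_None.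
Qed.

(** The recursion consults only children in [D], which have smaller depth, and their orbits; hence
    any fuel above [dep d] gives the same value. *)
Lemma sigma_rec_stable k n n' d :
  dep d < k -> dep d < n -> dep d < n' -> sigma_rec n d = sigma_rec n' d.
Proof.
elim: k n n' d => // k IHk [|n] [|n'] // d dk dn dn' /=.
case: (boolP (d \in Dstar)) => //= /Dstar_D dD; case: ifP => // _;
  case: ifP => // _.
have E y : dep y < dep d -> sigma_rec n y = sigma_rec n' y.
  by move=> yd; apply: IHk; apply: (leq_trans yd).
have EU : [set x in C_D d | sigma_rec n x] = [set x in C_D d | sigma_rec n' x].
  apply/setP => y; rewrite !inE; case: (boolP (y \in D)) => [yD|];
    last by rewrite andbF.
  by case: (boolP (covers y d)) => [yd|]; rewrite ?andbF // E // dep_lt.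
have EL y : y \in [set x in C_D d | sigma_rec n' x] ->
    last_iterate (sigma_rec n) y = last_iterate (sigma_rec n') y.
  rewrite inE in_C_D => /andP[/andP[yd yD] _]; apply: (eq_last_iterate E).
  - by move=> z c; exact: sigma_rec_dep.
  - by move=> z zN; rewrite !sigma_recN.
  - exact: dep_lt.
rewrite EU; apply: eq_pick => x; apply: andb_id2l => xU.
by apply: eq_forallb_in => y yU; rewrite !EL.
Qed.

Lemma sigmaN d : d \notin Dstar -> sigma d = None.
Proof. exact: sigma_recN. Qed.

Lemma sigma_covers d c : sigma d = Some c -> covers c d.
Proof. by case/sigma_rec_covers. Qed.

Lemma sigma_leaf d : d \in Dstar -> leaf d -> sigma d = largest (C_I d).
Proof.
move=> dS ld; have dD := Dstar_D dS.
by rewrite /Defs.sigma /= dS -dep_eq0 // in ld *; rewrite ld.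
Qed.

Lemma sigma_over_DL d : d \in Dstar -> ~~ leaf d -> C_D d \subset DL ->
  sigma d = largest (C_D d).
Proof.
move=> dS nl sub; have dD := Dstar_D dS.
by rewrite /Defs.sigma /= dS (dep_eq1 dD nl sub) sub.
Qed.

Lemma sigma_over_Dstar d : d \in Dstar -> ~~ (C_D d \subset DL) ->
  let U := [set d' in C_D d | sigma d'] in
  sigma d = [pick x in U | [forall y in U, onum num (mu y) <= onum num (mu x)]].
Proof.
move=> dS nsub /=; have dD := Dstar_D dS.
rewrite {1}/Defs.sigma /= dS (negPf nsub) andbF.
have -> : dep d == 0 = false.
  rewrite dep_eq0 //; apply: contraNF nsub => ld; case/andP: ld => _ /eqP ->.
  exact: sub0set.
have E y : dep y < dep d -> sigma_rec (dep d) y = sigma y.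
  by move=> yd; apply: (@sigma_rec_stable (dep d)).
have EU : [set x in C_D d | sigma_rec (dep d) x] = [set x in C_D d | sigma x].
  apply/setP => y; rewrite !inE; case: (boolP (y \in D)) => [yD|];
    last by rewrite andbF.
  by case: (boolP (covers y d)) => [yd|]; rewrite ?andbF // E // dep_lt.
have EL y : y \in [set x in C_D d | sigma x] ->
    last_iterate (sigma_rec (dep d)) y = mu y.
  rewrite inE in_C_D => /andP[/andP[yd yD] _].
  apply: (eq_last_iterate E).
  - by move=> z c; exact: sigma_rec_dep.
  - by move=> z zN; rewrite sigma_recN // /Defs.sigma sigma_recN.
  - exact: dep_lt.
rewrite EU; apply: eq_pick => x; apply: andb_id2l => xU.
by apply: eq_forallb_in => y yU; rewrite !EL.
Qed.

(** The inequality, which holds because numbers grow along an orbit of [sigma], keeps [q] within the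
    range of exponents used by [last_iterate]. *)
Lemma mu_reach d m q : iter q (obind sigma) (Some d) = Some m ->
  sigma m = None ->
  q + num d <= num m -> mu d = Some m.
Proof.
move=> qE mN le; apply: last_iterateE qE mN.
exact: leq_trans (leq_addr _ _) (leq_trans le (num_le m)).
Qed.

Lemma mu_sigma d c m q : sigma d = Some c ->
  iter q (obind sigma) (Some c) = Some m -> q + num c <= num m ->
  iter q.+1 (obind sigma) (Some d) = Some m /\ q.+1 + num d <= num m.
Proof.
move=> dE cE le; rewrite iterSr /= dE cE; split=> //.
apply: leq_trans le; rewrite addSn -addnS leq_add2l.
exact: covers_num (sigma_covers dE).
Qed.

(* In each of the three cases of the recursion, [mu d] is the last position
   occupied by a child of [d] or by [mu] of a child of [d]. *)
Lemma mu_ex d : d \in Dstar -> exists m,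
  [/\ exists2 q, iter q (obind sigma) (Some d) = Some m & q + num d <= num m,
      sigma m = None /\ height d < height m,
      exists2 c, covers c d & c = m \/ c \in Dstar /\ mu c = Some m,
      forall c, covers c d -> num c <= num m
    & forall c m', covers c d -> c \in Dstar -> mu c = Some m' ->
      num m' <= num m].
Proof.
have [n] := ubnP (dep d); elim: n d => // n IHn d dn dS.
have dD := Dstar_D dS.
have base c : sigma d = Some c -> c \notin Dstar ->
    (exists2 q, iter q (obind sigma) (Some d) = Some c & q + num d <= num c) /\
    (sigma c = None /\ height d < height c).
  move=> dc cN; have cd := sigma_covers dc; split.
    by exists 1; rewrite //= add1n (covers_num cd).
  by rewrite sigmaN // (covers_height cd).
case: (boolP (leaf d)) => ld.
  (* A leaf of [D] without children in [I] would be dead. *)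
  have : C_I d != set0.
    apply: contraTneq dS => C0; rewrite inE negb_and negbK orbC.
    by rewrite inE ld C0 cards0 /= dD.
  case/largestP=> m [mE mC maxm]; rewrite -sigma_leaf // in mE.
  have md : covers m d by rewrite -in_C_I.
  have mN : m \notin Dstar.
    by apply: contra (leaf_childN ld md); exact: Dstar_D.
  have [b1 b2] := base m mE mN; exists m; split=> //.
  - by exists m => //; left.
  - by move=> c cd; apply: maxm; rewrite in_C_I.
  - move=> c m' cd /Dstar_D cD; by case/negP: (leaf_childN ld cd).
case: (boolP (C_D d \subset DL)) => sub.
  have : C_D d != set0 by move: ld; rewrite /Defs.leaf dD.
  case/largestP=> m [mE mC maxm]; rewrite -sigma_over_DL // in mE.
  have mDL := subsetP sub m mC.
  move: (mC); rewrite in_C_D => /andP[md mD].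
  have mN : m \notin Dstar by rewrite inE mDL.
  have [b1 b2] := base m mE mN; exists m; split=> //.
  - by exists m => //; left.
  - move=> c cd; case: (boolP (c \in D)) => cD.
      by apply: maxm; rewrite in_C_D cd.
    (* Among children, which all have the same height, those outside [D] are numbered before those
       in [D]. *)
    case: num_adapted => _ _ _ _ H; apply/ltnW/H => //.
      by rewrite inE cD (covers_inl cd).
    by rewrite (covers_height cd) (covers_height md).
  - move=> c m' cd cS; have : c \in C_D d by rewrite in_C_D cd Dstar_D.
    by move/(subsetP sub) => cDL; move: cS; rewrite inE cDL.
have IH c : c \in C_D d -> c \in Dstar -> exists2 m, mu c = Some m &
    [/\ exists2 q, iter q (obind sigma) (Some c) = Some m & q + num c <= num m,
        sigma m = None & height c < height m].
  rewrite in_C_D => /andP[cd cD] cS.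
  have cn : dep c < n by exact: leq_trans (dep_lt cD dD cd) _.
  have [m [[q qE le] [mN hm] _ _ _]] := IHn c cn cS.
  by exists m; [exact: mu_reach qE mN le | split=> //; exists q].
have IHU c : (c \in [set d' in C_D d | sigma d']) = (c \in C_D d) && (c \in
  Dstar).
  rewrite inE; apply: andb_id2l => cC; apply/idP/idP.
    by apply: contraTT => /sigmaN ->.
  (* If [sigma] were undefined at [c], the orbit would end at [c] itself, but its end has strictly
     larger height. *)
  case/(IH c cC)=> m mE [[[|q] qE le] mN hm].
    by case: qE hm => ->; rewrite ltnn.
  by move: qE; rewrite iterSr /=; case: (sigma c) => //;
    rewrite iter_obind_None.
have [e eC eS] : exists2 e, e \in C_D d & e \in Dstar.
  case/subsetPn: sub => e eC eN; exists e => //.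
  by rewrite inE eN; move: eC; rewrite in_C_D => /andP[].
have := sigma_over_Dstar dS sub => /=.
case: pickP => [c /andP[cU /forall_inP maxc] dE|H]; last first.
  move=> _; have eU : e \in [set d' in C_D d | sigma d'] by rewrite IHU eC.
  case: (arg_maxnP (fun y => onum num (mu y)) eU) => c cU maxc.
  by have /negP[] := negbT (H c); apply/andP; split=> //; apply/forall_inP.
move: (cU); rewrite IHU => /andP[cC cS].
have [m mE [[q qE le] mN hm]] := IH c cC cS.
have [qE' le'] := mu_sigma dE qE le.
have cd := sigma_covers dE.
exists m; split.
- by exists q.+1.
- by split=> //; apply: leq_trans hm; rewrite (covers_height cd).
- by exists c => //; right.
(* The end [m] has larger height than [c], hence than every child of [d], and so a larger number. *)
- move=> c' c'd; case: num_adapted => _ _ _ H _.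
  have mI : m \in I.
    case: q qE {le qE' le'} => [[<-]|q]; first exact: covers_inl cd.
    rewrite iterS; case: (iter q _ _) => //= z /sigma_covers; exact: covers_inl.
  apply/ltnW/H => //; first exact: covers_inl c'd.
  by rewrite (covers_height c'd) -(covers_height cd).
move=> c' m' c'd c'S m'E.
have c'U : c' \in [set d' in C_D d | sigma d']
  by rewrite IHU in_C_D c'd Dstar_D.
by have := maxc c' c'U; rewrite m'E mE.
Qed.

Lemma mu_defined d : d \in Dstar -> exists m, mu d = Some m.
Proof. by case/mu_ex=> m [[q qE le] [mN _] _ _ _]; exists m;
  exact: mu_reach le. Qed.

Lemma muP d m : d \in Dstar -> mu d = Some m ->
  [/\ sigma m = None,
      exists2 c, covers c d & c = m \/ c \in Dstar /\ mu c = Some m,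
      forall c, covers c d -> num c <= num m
    & forall c m', covers c d -> c \in Dstar -> mu c = Some m' ->
      num m' <= num m].
Proof.
case/mu_ex=> m' [[q qE le] [mN _] H1 H2 H3].
by rewrite (mu_reach qE mN le) => -[<-].
Qed.

Lemma mu_connect d m : d \in Dstar -> mu d = Some m -> connect covers m d.
Proof.
elim/covers_ind: d => d IH dS dm; have [_ [c cd cE] _ _] := muP dS dm.
case: cE => [<-|[cS cm]]; first exact: connect1.
exact: connect_trans (IH c cd cS cm) (connect1 cd).
Qed.

Lemma mu_num d m : d \in Dstar -> mu d = Some m -> num d < num m.
Proof.
by move=> dS dm; have [_ [c cd _] /(_ c cd) + _] := muP dS dm;
  exact: leq_trans (covers_num cd).
Qed.

Lemma mu_I d m : d \in Dstar -> mu d = Some m -> m \in I.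
Proof.
elim/covers_ind: d => d IH dS dm; have [_ [c cd cE] _ _] := muP dS dm.
by case: cE => [<-|[cS cm]]; [exact: covers_inl cd | exact: IH cm].
Qed.

(** * Contents of the factors *)

Hypothesis I_simply_laced : forall i j, i \in I -> j \in I -> i != j ->
  (a i j = 0 \/ a i j = -1)%R.

Lemma cartan_adj i j : adj i j -> a i j = (-1)%R.
Proof. by case/and4P=> iI jI /(I_simply_laced iI jI) []// -> /eqP. Qed.

Lemma cartan_nadj i j : i \in I -> j \in I -> i != j -> ~~ adj i j ->
  a i j = 0%R.
Proof. by rewrite /Defs.adj /= => -> -> ->; rewrite negbK => /eqP. Qed.

(* Dominance of [lambda_{D,I}] enters only here. *)
Lemma dead_leaf_parent d : d \in DL ->
  (0 <= 2 - \sum_(i in I) a d i - \sum_(j in D) a d j)%R ->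
    exists y, covers d y.
Proof.
move=> dL; have dD : d \in D by case/andP: (DL_leaf dL).
have dI := subsetP D_sub_I _ dD.
case: (pselect (exists y, covers d y)) => // no_parent.
have adjE i : adj d i = covers i d.
  by rewrite adj_covers; case: (boolP (covers d i)) => // di; case: no_parent;
    exists i.
have [add _ _] := a_gcm.
(* Without a parent the pairing would be 2 - (2 - c) - 2 = c - 2 with c = |C_I(d)| at most 1, hence
   negative. *)
have -> : (\sum_(i in I) a d i = 2 - #|C_I d|%:Z)%R.
  rewrite (big_setD1 d dI) /= add; congr (_ + _)%R.
  rewrite -sum1_card -natz natr_sum -sumrN big_mkcond [RHS]big_mkcond /=.
  apply: eq_bigr => i _; rewrite in_setD1 in_C_I -adjE.
  case: (boolP (adj d i)) => di; first by rewrite (cartan_adj di);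
    case/and4P: di => _ -> + _; rewrite eq_sym => ->.
  by case: ifP => // /andP[id_ iI]; rewrite cartan_nadj // eq_sym.
have -> : (\sum_(j in D) a d j = 2)%R.
  rewrite (big_setD1 d dD) /= add big1 ?addr0 // => i;
    rewrite in_setD1 => /andP[id_ iD].
  apply: cartan_nadj => //; [exact: (subsetP D_sub_I) | by rewrite eq_sym | ].
  by rewrite adjE; apply: contraL iD => cov;
    exact: leaf_childN (DL_leaf dL) cov.
by move: dL; rewrite inE => /andP[_]; lia.
Qed.

Hypothesis DL_parent : forall d, d \in DL -> exists y, covers d y.

Local Notation M := (M a I D rts num).
Local Notation Lline := (Lline a I D rts num).
Local Notation inc := (inc num).

Lemma DL_D d : d \in DL -> d \in D.
Proof. by move/DL_leaf/andP=> []. Qed.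

Lemma D_cases d : d \in D -> d \in DL \/ d \in Dstar.
Proof. by move=> dD; case: (boolP (d \in DL)) => dL; [left | right;
  rewrite inE dL]. Qed.

Lemma DstarN_DL d : d \in Dstar -> (d \in DL) = false.
Proof. by rewrite in_setD => /andP[/negPf]. Qed.

(* The factor on which [f_d] acts. *)
Definition pos (d : Delta) : Delta :=
  if d \in DL then odflt d [pick y | covers d y] else odflt d (mu d).

Lemma pos_DL d : d \in DL -> covers d (pos d).
Proof.
move=> dL; rewrite /pos dL; case: pickP => [//|H].
by have [y] := DL_parent dL; rewrite H.
Qed.

Lemma pos_Dstar d : d \in Dstar -> mu d = Some (pos d).
Proof. by move=> dS; rewrite /pos (DstarN_DL dS);
  have [m ->] := mu_defined dS. Qed.

Lemma pos_DLE d y : d \in DL -> covers d y -> pos d = y.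
Proof. by move=> dL /(covers_fun (pos_DL dL)). Qed.

Lemma pos_DstarE d m : d \in Dstar -> mu d = Some m -> pos d = m.
Proof. by move=> /pos_Dstar -> [->]. Qed.

Lemma pos_Dstar_num d : d \in Dstar -> num d < num (pos d).
Proof. by move=> dS; exact: mu_num (pos_Dstar dS). Qed.

Lemma pos_neq d : d \in D -> pos d != d.
Proof.
case/D_cases=> [/pos_DL/covers_num | /pos_Dstar_num];
  by apply: contraTneq => ->; rewrite ltnn.
Qed.

(* The simple roots subtracted in the factor [h] once [f_i] has acted for all
   [i] in [I] and all [i] in [X]. *)
Definition content (X : {set Delta}) (h : Delta) : {set Delta} :=
  [set i in I | i == h] :|: [set i in X | pos i == h].

Lemma in_content (X : {set Delta}) h i :
  (i \in content X h) = (i \in I) && (i == h) || (i \in X) && (pos i == h).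
Proof. by rewrite !inE. Qed.

(** The word [inc D] acts from its right end, so these are the elements whose operators have already
    acted when f_d is applied. *)
Definition above (d : Delta) : {set Delta} := [set i in D | num d < num i].

Lemma in_above d i : (i \in above d) = (i \in D) && (num d < num i).
Proof. by rewrite inE. Qed.

Lemma adj_num i d : adj d i -> num d < num i -> covers i d.
Proof.
rewrite adj_covers => /orP[/covers_num lt|//] gt.
by have := ltn_trans lt gt; rewrite ltnn.
Qed.

Lemma content_adj d h i : i \in content (above d) h -> adj d i ->
  i = h \/ [/\ i \in D, covers i d & pos i = h].
Proof.
rewrite in_content => /orP[/andP[_ /eqP ->]|]; first by left.
by rewrite in_above => /andP[/andP[iD lt] /eqP <-] di; right; split=> //;
  exact: adj_num.
Qed.

Lemma contentI (X : {set Delta}) h : X \subset D -> content X h \subset I.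
Proof.
move=> sXD; apply/subsetP => i;
  rewrite in_content => /orP[/andP[]|/andP[iX _]] //.
by apply: (subsetP D_sub_I); exact: (subsetP sXD).
Qed.

Lemma above_sub d : above d \subset D.
Proof. by apply/subsetP => i; rewrite in_above => /andP[]. Qed.

Lemma content_aboveN d h : h != d -> d \notin content (above d) h.
Proof.
by move=> hd; rewrite in_content in_above ltnn andbF orbF eq_sym (negPf hd)
  andbF.
Qed.

(** A dead leaf acts on its parent, whereas [mu i] is numbered above [i]. Hence only the dead leaves
    over [d] have acted on the factor [d]. *)
Lemma content_above d : d \in D -> content (above d) d = d |: DL_at d.
Proof.
move=> dD; apply/setP => i; rewrite in_content in_above in_setU1.
rewrite [i \in DL_at d]inE.
case: (eqVneq i d) => [->|id]; first by rewrite (subsetP D_sub_I).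
rewrite andbF /=; apply/idP/idP => [/andP[/andP[iD lt] /eqP pE]|/andP[iL cov]].
  case: (D_cases iD) => [iL|iS]; first by rewrite iL -pE pos_DL.
  by have := ltn_trans lt (pos_Dstar_num iS); rewrite pE ltnn.
by rewrite (DL_D iL) (covers_num cov) (pos_DLE iL cov) eqxx.
Qed.

Lemma in_DL_at i d : (i \in DL_at d) = (i \in DL) && covers i d.
Proof. by rewrite inE. Qed.

(** By the recursion for [mu], the factor [mu d] either belongs to a child of [d] or carries the
    letter of a child: the partial sum increases there. *)
Lemma content_star_pos d : d \in Dstar ->
  exists2 c, c \in content (above d) (pos d) & adj d c.
Proof.
move=> dS; have [_ [c cd cE] _ _] := muP dS (pos_Dstar dS).
exists c; last by rewrite adj_covers cd orbT.
rewrite in_content; case: cE => [<-|[cS cm]].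
  by rewrite eqxx (covers_inl cd).
by rewrite in_above (Dstar_D cS) (covers_num cd) (pos_DstarE cS cm) eqxx orbT.
Qed.

(** Maximality of [mu d] over all children and their [mu] values excludes any increment beyond
    it. *)
Lemma content_star_after d h i : d \in Dstar -> num (pos d) < num h ->
  i \in content (above d) h -> ~~ adj d i.
Proof.
move=> dS lt iC; apply/negP => di.
have [_ _ H1 H2] := muP dS (pos_Dstar dS).
have dp := pos_Dstar_num dS.
case: (content_adj iC di) => [ih|[iD cov pE]].
  rewrite ih in di; have := H1 _ (adj_num di (ltn_trans dp lt)).
  by rewrite leqNgt lt.
case: (D_cases iD) => [iL|iS].
  by have := ltn_trans dp lt; rewrite -pE (pos_DLE iL cov) ltnn.
by have := H2 _ _ cov iS (pos_Dstar iS); rewrite pE leqNgt lt.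
Qed.

(** A vivid leaf has two children. Otherwise some child [c] lies in [Dstar], and both its own factor
    and the factor [mu c] carry the letter [c]. *)
Lemma content_star_two d : d \in Dstar -> DL_at d = set0 ->
  exists h1 h2, [/\ h1 != h2, num d < num h1, num d < num h2,
    exists2 c, c \in content (above d) h1 & adj d c &
    exists2 c, c \in content (above d) h2 & adj d c].
Proof.
move=> dS dL0; have dD := Dstar_D dS.
have child c : covers c d -> exists2 i, i \in content (above d) c & adj d i.
  move=> cd; exists c; last by rewrite adj_covers cd orbT.
  by rewrite in_content eqxx (covers_inl cd).
case: (boolP (leaf d)) => ld.
  have /card_gt1P[h1 [h2 []]] : 1 < #|C_I d|.
    by have := DstarN_DL dS; rewrite inE ld /= => /negbT; rewrite -ltnNge.
  rewrite !in_C_I => c1 c2 neq; exists h1, h2.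
  by split; rewrite ?covers_num //; exact: child.
move: ld; rewrite /Defs.leaf dD /= => /set0Pn[c];
  rewrite in_C_D => /andP[cd cD].
have cS : c \in Dstar.
  case: (D_cases cD) => // cL; have := in_DL_at c d.
  by rewrite dL0 cL cd inE.
have cp := pos_Dstar_num cS; have dc := covers_num cd.
exists c, (pos c); split=> //.
- by apply: contraTneq cp => <-; rewrite ltnn.
- exact: ltn_trans dc cp.
- exact: child.
exists c; last by rewrite adj_covers cd orbT.
by rewrite in_content in_above cD dc eqxx orbT.
Qed.

Lemma content_dead d h i : d \in DL -> i \in content (above d) h -> adj d i ->
  i = h.
Proof.
move=> dL iC /(content_adj iC)[//|[iD cov _]].
by have := leaf_childN (DL_leaf dL) cov; rewrite iD.
Qed.

Lemma DL_at_dead d : d \in DL -> DL_at d = set0.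
Proof.
move=> dL; apply/setP => i; rewrite in_DL_at in_set0;
  apply/negP => /andP[/DL_D iD].
by move/(leaf_childN (DL_leaf dL)); rewrite iD.
Qed.

(** An anchor point is a child of a leaf of [D], hence outside [D]; a dead leaf over it would make
    it a ground point. *)
Lemma anchor_DL_at m : anchor_point a I D rts num m -> ~~ ground a I D rts m ->
  DL_at m = set0.
Proof.
case/existsP=> d /andP[vd /eqP dm] ng.
have /andP[ld cd] := vd; have dD : d \in D by case/andP: ld.
have dS : d \in Dstar by rewrite inE dD andbT inE ld /= -ltnNge.
rewrite sigma_leaf // in dm; have := largest_in dm; rewrite in_C_I => md.
apply/setP => i; rewrite in_DL_at in_set0; apply/negP => /andP[iL im].
case/negP: ng; rewrite /ground (leaf_childN ld md) andbT.
by apply/exists_inP; exists i.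
Qed.

(** * The words of the factors *)

Lemma inc_uniq (X : {set Delta}) : uniq (inc X).
Proof. by rewrite sort_uniq enum_uniq. Qed.

Lemma mem_inc (X : {set Delta}) i : (i \in inc X) = (i \in X).
Proof. by rewrite mem_sort mem_enum. Qed.

Lemma inc_split (X : {set Delta}) w1 s w2 : inc X = w1 ++ s :: w2 ->
  s \in X /\ forall i, (i \in w2) = (i \in X) && (num s < num i).
Proof.
move=> E; have sX : s \in X by rewrite -mem_inc E mem_cat inE eqxx orbT.
split=> // i; have : pairwise (fun s t => num s <= num t) (inc X).
  rewrite -sorted_pairwise; first by apply: sort_sorted => x y;
    exact: leq_total.
  by move=> x y z; exact: leq_trans.
rewrite E pairwise_cat pairwise_cons =>
  /and3P[/allrelP lt1 _ /andP[/allP lt2 _]].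
have := inc_uniq X; rewrite E cat_uniq /= => /and4P[_ /norP[_ w12] sw2 _].
rewrite -mem_inc E mem_cat inE; case: (boolP (i \in w2)) => iw2.
  rewrite !orbT /= ltn_neqAle lt2 // andbT; apply/esym.
  by apply: contraNneq sw2 => /num_inj ->.
rewrite orbF; apply/esym/negP => /andP[/orP[iw1|/eqP->]]; last by rewrite ltnn.
by rewrite ltnNge lt1 // inE eqxx.
Qed.

Definition line_above (k : Delta) : {set Delta} := [set d in Dstar | mu d ==
  Some k].

(** One formula for all the cases of [yword]: the sets that do not occur in a given case are empty
    there. *)
Definition factor_word (k : Delta) : seq Delta :=
  inc (DL_at k) ++ inc (line_above k) ++ (if k \in I then [:: k] else [::]).

Lemma Lline_above k : Lline k :\ k = line_above k.
Proof.
apply/setP => d; rewrite in_setD1 in_setU1.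
rewrite [d \in [set _ in _ | _]]inE [d \in line_above k]inE.
case: (eqVneq d k) => [->|_] /=.
  by apply/esym/negP => /andP[kS /eqP/(mu_num kS)]; rewrite ltnn.
apply: andb_id2l => dS; case: eqP => [dm|]; last by rewrite andbF.
by rewrite andbT (mu_connect dS dm).
Qed.

Lemma yword_factor k : yword a I D rts num k = factor_word k.
Proof.
have inc0 : inc set0 = [::] by rewrite /Defs.inc enum_set0.
rewrite /yword /factor_word Lline_above; case: ifP => kM.
  suff -> : k \in I by [].
  move: kM; rewrite inE => /exists_inP[d dS /eqP]; exact: mu_I.
have -> : line_above k = set0.
  apply/setP => d; rewrite [d \in line_above k]inE in_set0;
    apply/negP => /andP[dS dm].
  have : k \in M by rewrite inE; apply/exists_inP; exists d.
  by rewrite kM.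
rewrite inc0 /= /receiving /ground -andb_orr orbN andbT.
case: exists_inP => [[d dL dk]|ne]; first by rewrite (covers_inr dk).
suff -> : DL_at k = set0 by rewrite inc0 /=; case: ifP.
apply/setP => i; rewrite in_DL_at in_set0; apply/negP => /andP[iL ik].
by apply: ne; exists i.
Qed.

Lemma in_line_above d k : d \in line_above k -> d \in Dstar /\ mu d = Some k.
Proof. by rewrite inE => /andP[-> /eqP ->]. Qed.

Lemma mem_tail k i : (i \in if k \in I then [:: k] else [::]) = (i \in I) && (i
  == k).
Proof.
case: ifP => kI; rewrite ?mem_seq1 ?in_nil.
  by case: eqP => [->|]; rewrite ?kI ?andbF.
by case: eqP => [->|]; rewrite ?kI ?andbF.
Qed.

Lemma mem_factor_word k i : (i \in factor_word k) = (i \in content D k).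
Proof.
rewrite !mem_cat !mem_inc mem_tail in_content orbA orbC; congr (_ || _).
rewrite in_DL_at; apply/orP/andP =>
  [[/andP[iL ik]|/in_line_above[iS im]]|[iD /eqP ik]].
- by rewrite DL_D // (pos_DLE iL ik).
- by rewrite Dstar_D // (pos_DstarE iS im).
case: (D_cases iD) => [iL|iS]; first by left; rewrite iL -ik pos_DL.
by right; rewrite inE iS (pos_Dstar iS) ik eqxx.
Qed.

Lemma factor_word_uniq k : uniq (factor_word k).
Proof.
have tail_uniq : uniq (if k \in I then [:: k] else [::]) by case: ifP.
rewrite cat_uniq inc_uniq cat_uniq inc_uniq tail_uniq andbT /=; apply/andP;
  split.
  apply/hasPn => i; rewrite mem_cat mem_tail !mem_inc in_DL_at.
  case/orP=> [/in_line_above[iS im]|/andP[_ /eqP ->]].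
    by rewrite DstarN_DL.
  by apply/negP => /andP[_ /covers_num]; rewrite ltnn.
apply/hasPn => i; rewrite mem_tail mem_inc => /andP[_ /eqP ->].
by apply/negP => /in_line_above[kS /mu_num] /(_ kS); rewrite ltnn.
Qed.

Lemma unit_steps_inc k (X : {set Delta}) v :
  k \notin X -> uniq (inc X ++ v) -> unit_steps a k v ->
  (forall s, s \in X -> exists c,
     [/\ c \in X /\ num s < num c \/ c \in v, a s c = (-1)%R
       & forall i, i \in X /\ num s < num i \/ i \in v -> i != c ->
         a s i = 0%R]) ->
  unit_steps a k (inc X ++ v).
Proof.
move=> kX uXv v1 H.
suff gen w1 w2 : inc X = w1 ++ w2 -> unit_steps a k (w2 ++ v).
  by apply: (gen [::]).
elim: w2 w1 => [|s w2 IHw] w1 E //=.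
rewrite (IHw (rcons w1 s)) ?cat_rcons // andbT.
have [sX w2E] := inc_split E; have [c [cin c1 c0]] := H s sX.
have -> : (k == s) = false by apply: contraNF kX => /eqP ->.
have mem_w2v i : reflect (i \in X /\ num s < num i \/ i \in v) (i \in w2 ++ v).
  rewrite mem_cat w2E; apply: (iffP orP) => [[/andP|]|[/andP|]];
    by [left|right].
rewrite (bigD1_seq c) /=; last 2 first.
- exact/mem_w2v.
- by move: uXv; rewrite E -catA cat_uniq => /and3P[_ _] /= /andP[].
rewrite c1 big_seq_cond big1 // => i /andP[/mem_w2v iin ic]; exact: c0.
Qed.

(** The gradient line lies on the root path of [k], where each letter has a single child; a dead
    leaf over [k] meets only [k]. So every letter other than [k] has exactly one neighbour to its
    right. *)
Lemma factor_word_steps k : unit_steps a k (factor_word k).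
Proof.
have kL : k \notin line_above k.
  by apply/negP => /in_line_above[kS /mu_num] /(_ kS); rewrite ltnn.
have kDL : k \notin DL_at k by rewrite in_DL_at;
  apply/negP => /andP[_ /covers_num]; rewrite ltnn.
have u := factor_word_uniq k.
have tail1 : unit_steps a k (if k \in I then [:: k] else [::]).
  by case: ifP; rewrite //= eqxx big_nil.
apply: unit_steps_inc => //; first apply: unit_steps_inc => //.
- by move: u; rewrite cat_uniq => /and3P[].
- move=> s /in_line_above[sS sm].
  have sI := subsetP D_sub_I _ (Dstar_D sS).
  have [_ [c cs cE] _ _] := muP sS sm.
  have kI := mu_I sS sm; rewrite kI.
  exists c; split.
  + case: cE => [->|[cS cm]]; first by right; rewrite inE.
    by left; rewrite inE cS cm eqxx (covers_num cs).
  + by apply: cartan_adj; rewrite adj_covers cs orbT.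
  have kc : connect covers k c by case: cE => [->|[cS cm]] //;
    exact: mu_connect.
  move=> i iin ic; have [iI lt ki] : [/\ i \in I, num s < num i & connect
    covers k i].
    case: iin => [[/in_line_above[iS im] lt]|].
      by split=> //; [exact: subsetP D_sub_I _ (Dstar_D iS) | exact:
        mu_connect].
    by rewrite inE => /eqP ->; rewrite kI connect0 (mu_num sS sm).
  apply: cartan_nadj => //; first by apply: contraTneq lt => ->; rewrite ltnn.
  apply: contra ic => /adj_num/(_ lt) is_; apply/eqP.
  exact: child_on_rootpath_unique is_ cs ki kc.
move=> s; rewrite in_DL_at => /andP[sL sk]; have kI := covers_inr sk.
rewrite kI; exists k; split.
- by right; rewrite mem_cat inE eqxx orbT.
- by apply: cartan_adj; exact: covers_adj.
have sI := covers_inl sk.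
move=> i iin ik; case: iin => [[]|].
  rewrite in_DL_at => /andP[_ ik'] lt; apply: cartan_nadj => //.
  - exact: covers_inl ik'.
  - by apply: contraTneq lt => ->; rewrite ltnn.
  - exact: adj_siblings sk ik'.
rewrite mem_cat mem_inc mem_seq1 (negPf ik) orbF => /in_line_above[iS im].
have lt := mu_num iS im; apply: cartan_nadj => //.
- exact: subsetP D_sub_I _ (Dstar_D iS).
- by apply: contraTneq (ltn_trans lt (covers_num sk)) => ->; rewrite ltnn.
(* The parent of [s] is [k], and [i] is no child of [s] because its number is below that of [k]. *)
rewrite adj_covers; apply/negP => /orP[/(covers_fun sk) ki|/covers_num].
  by rewrite ki eqxx in ik.
by rewrite ltnNge (ltnW (ltn_trans lt (covers_num sk))).
Qed.

(** * Action of the words on the tensor product *)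

Local Open Scope ring_scope.

Section TensorProduct.
Variables (R : realType) (g : realization a R) (omega : Delta -> weight g).
Hypothesis omegaP : forall k s, omega k (coroot g s) = (k == s)%:R.
Variables (B : Delta -> crystal g) (pi : tensor B).
Hypothesis B_support : forall k (x : B k),
  exists c : Delta -> nat, wt x = omega k - \sum_i sroot g i *+ c i.
Hypothesis B_highest : forall k (x y : B k), wt x = omega k ->
  wt y = omega k -> x = y.
Hypothesis pi_wt : forall k, wt (pi k) = omega k.

Let tf := tensor_f num (B := B).

(** Only the weights of the factors are tracked; uniqueness in each final weight recovers the
    elements afterwards. *)
Definition has_content (S : Delta -> {set Delta}) (x : tensor B) : Prop :=
  forall h, wt (x h) = omega h - \sum_(i in S h) sroot g i.

Lemma has_content_step (S S' : Delta -> {set Delta}) x s p y :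
  has_content S x -> fcr s (x p) = Some y -> s \notin S p ->
  S' p = s |: S p -> (forall h, h != p -> S' h = S h) ->
    has_content S' (dfwith x y).
Proof.
move=> Sx yE sp Sp Sh h; case: (eqVneq h p) => [->|hp]; last first.
  by rewrite dfwith_out ?(eq_sym p) // Sh.
by rewrite dfwith_in (fcr_wt yE) Sx Sp big_setU1 //= opprD addrA addrAC.
Qed.

Lemma cartan_le0 s i : i != s -> a s i <= 0.
Proof. by case: a_gcm => _ H _ is_; rewrite H // eq_sym. Qed.

Lemma cartan_diag s : a s s = 2.
Proof. by case: a_gcm. Qed.

Lemma content_eps0 S x s h : has_content S x -> s \notin S h ->
  eps s (x h) = 0%N.
Proof.
move=> Sx /negPf sS; apply/eqP; rewrite -leqn0.
by have := eps_le (@B_support h) s (Sx h); rewrite sS.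
Qed.

Lemma content_wti S x s h : has_content S x ->
  wti s (x h) = (h == s)%:Z - \sum_(i in S h) a s i.
Proof. by move=> Sx; exact: (wti_set (omegaP h)). Qed.

Lemma content_wti_ge0 S x s h : has_content S x -> h != s -> s \notin S h ->
  0 <= wti s (x h).
Proof.
move=> Sx /negPf hs sS; rewrite (content_wti _ _ Sx) hs sub0r oppr_ge0.
by apply: sumr_le0 => i iS; apply: cartan_le0; apply: contraNneq sS => <-.
Qed.

Lemma sum_cartan_adj (S : {set Delta}) s c : s \notin S -> c \in S -> adj s c ->
  \sum_(i in S) a s i <= -1.
Proof.
move=> sS cS sc; rewrite (big_setD1 c cS) /= (cartan_adj sc) gerDl.
apply: sumr_le0 => i; rewrite inE => /andP[_ iS]; apply: cartan_le0.
by apply: contraNneq sS => <-.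
Qed.

Lemma content_wti_gt0 S x s h c : has_content S x -> h != s -> s \notin S h ->
  c \in S h -> adj s c -> 0 < wti s (x h).
Proof.
move=> Sx /negPf hs sS cS sc; rewrite (content_wti _ _ Sx) hs sub0r oppr_gt0.
by apply: le_lt_trans (sum_cartan_adj sS cS sc) _.
Qed.

Lemma content_wti_eq0 S x s h : has_content S x -> h != s -> s \notin S h ->
  s \in I -> S h \subset I -> (forall i, i \in S h -> ~~ adj s i) ->
    wti s (x h) = 0.
Proof.
move=> Sx /negPf hs sS sI SI nadj;
  rewrite (content_wti _ _ Sx) hs sub0r big1 ?oppr0 // => i iS.
apply: cartan_nadj => //; last exact: nadj.
  exact: (subsetP SI).
by apply: contraNneq sS => ->.
Qed.

Lemma fword_step (T : Type) (f : Delta -> T -> option T) s w x y :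
  fword f w x = Some y -> fword f (s :: w) x = f s y.
Proof. by move=> xE; rewrite /fword /= -[foldr _ _ _]/(fword f w x) xE. Qed.

(** The letters already applied have smaller numbers, and each sits on its own factor. So factors
    before [s] pair non-negatively with its coroot, [s] pairs to 1, and the untouched later ones
    pair to 0. *)
Lemma fword_descending w1 w : rev (inc I) = w1 ++ w -> exists x,
  fword tf w pi = Some x /\ has_content (fun h => [set i in w | i == h]) x.
Proof.
elim: w w1 => [|s w IHw] w1 E.
  exists pi; split=> // h; rewrite big1 ?subr0 // => i.
  by rewrite inE in_nil.
have [|x [xE Sx]] := IHw (rcons w1 s); first by rewrite cat_rcons.
have E' : inc I = rev w ++ s :: rev w1.
  by rewrite -[LHS]revK E rev_cat rev_cons -cats1 -catA.
have [sI aboveE] := inc_split E'.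
have := inc_uniq I; rewrite -rev_uniq E cat_uniq => /and3P[_ _ /= /andP[sw _]].
have below i : i \in w -> (num i < num s)%N.
  move=> iw; rewrite ltn_neqAle leqNgt; apply/andP; split.
    by apply: contraNneq sw => /num_inj <-.
  have iI : i \in I by rewrite -mem_inc E' mem_cat mem_rev iw.
  have := inc_uniq I; rewrite E' cat_uniq => /and3P[_ /hasPn H _].
  apply/negP => si; have := H i; rewrite inE aboveE iI si orbT mem_rev iw.
  by move=> /(_ isT).
have sNS h : s \notin [set i in w | i == h] by rewrite inE (negPf sw).
have wt_s : wti s (x s) = 1.
  rewrite (content_wti _ _ Sx) eqxx big1 ?subr0 // => i;
    rewrite inE => /andP[iw /eqP is_].
  by move: sw; rewrite -is_ iw.
have [||h|h sh|y [yE fE]] := @tensor_f_nonneg _ _ _ _ _ B num_inj s x s.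
- by rewrite wt_s.
- by move=> h; exact: content_eps0 Sx (sNS h).
- case: (eqVneq h s) => [->|hs]; first by rewrite wt_s.
  exact: (content_wti_ge0 Sx hs (sNS h)).
- have hs : h != s by apply: contraTneq sh => ->; rewrite ltnn.
  rewrite (content_wti _ _ Sx) (negPf hs) big1 // => i;
    rewrite inE => /andP[iw /eqP ih].
  by have := below i iw; rewrite ih ltnNge (ltnW sh).
exists (dfwith x y); split; first by rewrite -fE; exact: fword_step.
apply: (has_content_step Sx yE (sNS s)).
  by apply/setP => i; rewrite !inE; case: eqP.
move=> h hs; apply/setP => i; rewrite !inE; case: (eqVneq i s) => [->|] //=.
by rewrite (eq_sym s) (negPf hs) andbF.
Qed.

(** The first maximum is found by [tensor_f_one] for a dead leaf, by [tensor_f_two] if [d] is in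
    [Dstar] with no dead leaf over it, and by [tensor_f_nonneg] otherwise. *)
Lemma tensor_f_pos d x : d \in D -> has_content (content (above d)) x ->
  exists y, fcr d (x (pos d)) = Some y /\ tf d x = Some (dfwith x y).
Proof.
move=> dD Sx; have dI := subsetP D_sub_I _ dD.
have SI h : content (above d) h \subset I by apply: contentI; exact: above_sub.
have dN h : h != d -> d \notin content (above d) h by exact: content_aboveN.
have eps0 h : h != d -> eps d (x h) = 0%N by move=> /dN;
  exact: (content_eps0 Sx).
have epsd : (eps d (x d) <= 1)%N.
  by apply: leq_trans (eps_le (@B_support d) d (Sx d)) _; case: (d \in _).
have W0 h : h != d -> 0 <= wti d (x h).
  by move=> hd; exact: (content_wti_ge0 Sx hd (dN h hd)).
have dDL : d \notin DL_at d by rewrite in_DL_at;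
  apply/negP => /andP[_ /covers_num]; rewrite ltnn.
(* The letter [d] turns 1 into -1, and every dead leaf over [d] adds 1 back. *)
have Wd : wti d (x d) = -1 - \sum_(i in DL_at d) a d i.
  rewrite (content_wti _ _ Sx) eqxx content_above // big_setU1 //= cartan_diag.
  by rewrite opprD addrA.
case: (D_cases dD) => [dL|dS].
  have cov := pos_DL dL; have pd := covers_num cov.
  (* A dead leaf has no child in [D], so its only possible neighbour in the content of [h] is [h]
     itself. *)
  have adjE h : h != d -> wti d (x h) = (adj d h)%:Z.
    move=> hd; have dNh := dN h hd; case: (boolP (adj d h)) => dh; last first.
      apply: (content_wti_eq0 Sx) => // i iS; apply: contra dh => di.
      by rewrite -(content_dead dL iS di).
    have hS : h \in content (above d) h.
      by rewrite in_content eqxx andbT; case/and4P: dh => _ ->.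
    rewrite (content_wti _ _ Sx) (negPf hd) (big_setD1 h hS) /= (cartan_adj dh)
      big1 ?addr0 // => i.
    rewrite in_setD1 => /andP[ih iS]; apply: cartan_nadj => //.
    - exact: (subsetP (SI h)).
    - by apply: contraNneq dNh => {1}->.
    - by apply: contra ih => di; rewrite (content_dead dL iS di).
  have ltN h : (num h < num d)%N -> h != d by apply: contraTneq => ->;
    rewrite ltnn.
  have gtN h : (num d < num h)%N -> h != d by apply: contraTneq => ->;
    rewrite ltnn.
  apply: (@tensor_f_one _ _ _ _ _ B num_inj d x (pos d) d) => //.
  - by rewrite adjE ?ltN // covers_adj.
  - move=> h hd hp; rewrite adjE ?ltN //; case: (boolP (adj d h)) => //.
    rewrite adj_covers => /orP[dh|/covers_num].
      by rewrite (pos_DLE dL dh) eqxx in hp.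
    by rewrite ltnNge (ltnW hd).
  - by rewrite Wd (DL_at_dead dL) big_set0 subr0.
  - by move=> h /gtN; exact: W0.
  have -> : \sum_(h in [set h | (num d < num h)%N]) wti d (x h) = #|C_I d|%:Z.
    rewrite -sum1_card -natz natr_sum big_mkcond [RHS]big_mkcond /=.
    apply: eq_bigr => h _; rewrite inE in_C_I; case: ifP => dh.
      rewrite adjE ?gtN // adj_covers;
        case: (boolP (covers d h)) => [/covers_num|_ /=].
        by rewrite ltnNge (ltnW dh).
      by case: ifP.
    by case: ifP => // /covers_num; rewrite dh.
  by rewrite lez_nat; move: dL; rewrite inE => /andP[].
have dp := pos_Dstar_num dS.
have [c cS dc] := content_star_pos dS.
have pNd : pos d != d by exact: pos_neq.
have Wp : 0 < wti d (x (pos d))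
  by exact: (content_wti_gt0 Sx pNd (dN _ pNd) cS dc).
have Wafter h : (num (pos d) < num h)%N -> wti d (x h) = 0.
  move=> ph; have hd : h != d by apply: contraTneq (ltn_trans dp ph) => ->;
    rewrite ltnn.
  by apply: (content_wti_eq0 Sx) => //; [exact: dN | move=> i;
    exact: content_star_after].
(* A dead leaf over [d] cancels the drop at [d] and makes eps_d vanish there; without one, two
   increments after [d] are needed. *)
case: (set_0Vmem (DL_at d)) => [dL0|[j jDL]].
  have [h1 [h2 [h12 dh1 dh2 [c1 c1S dc1] [c2 c2S dc2]]]] := content_star_two dS
    dL0.
  have gtN h : (num d < num h)%N -> h != d by apply: contraTneq => ->;
    rewrite ltnn.
  apply: (@tensor_f_two _ _ _ _ _ B num_inj d x (pos d) d h1 h2) => //.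
  - by rewrite Wd dL0 big_set0 subr0.
  - exact: (content_wti_gt0 Sx (gtN _ dh1) (dN _ (gtN _ dh1)) c1S dc1).
  - exact: (content_wti_gt0 Sx (gtN _ dh2) (dN _ (gtN _ dh2)) c2S dc2).
have jd : covers j d by move: jDL; rewrite in_DL_at => /andP[].
apply: (tensor_f_nonneg num_inj) => //.
- move=> h; case: (eqVneq h d) => [->|]; last exact: eps0.
  apply: (eps_top_eq0 a_gcm (omegaP d) (@B_support d) (Sx d) (j := j)).
  + by rewrite content_above // in_setU1 eqxx.
  + by rewrite content_above // in_setU1 jDL orbT.
  + exact: covers_neq.
  move=> i; rewrite content_above // in_setU1 => /orP[/eqP->|];
    first by rewrite eqxx.
  rewrite in_DL_at => /andP[_ id_] ij _; apply: cartan_nadj.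
  + exact: covers_inl jd.
  + exact: covers_inl id_.
  + by rewrite eq_sym.
  + exact: adj_siblings jd id_.
move=> h; case: (eqVneq h d) => [->|]; last exact: W0.
rewrite Wd; have := sum_cartan_adj dDL jDL;
  rewrite adj_covers jd orbT => /(_ isT).
by rewrite subr_ge0.
Qed.

Lemma fword_ascending w1 w : inc D = w1 ++ w -> exists x,
  fword tf (w ++ rev (inc I)) pi = Some x /\ has_content (content [set i in w])
    x.
Proof.
elim: w w1 => [|d w IHw] w1 E.
  have [x [xE Sx]] := @fword_descending [::] (rev (inc I)) erefl.
  exists x; split=> // h; rewrite Sx; congr (_ - _); apply: eq_bigl => i.
  by rewrite in_content !inE mem_rev mem_inc in_nil orbF.
have [|x [xE Sx]] := IHw (rcons w1 d); first by rewrite cat_rcons.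
have [dD wE] := inc_split E.
have abE : [set i in w] = above d by apply/setP => i; rewrite in_above inE wE.
rewrite abE in Sx; have [y [yE fE]] := tensor_f_pos dD Sx.
exists (dfwith x y); split; first by rewrite -fE; exact: fword_step.
have abE' : [set i in d :: w] = d |: above d by apply/setP => i;
  rewrite -abE !inE.
rewrite abE'; apply: (has_content_step Sx yE).
- by apply: content_aboveN; exact: pos_neq.
- apply/setP => i; rewrite in_setU1 !in_content in_setU1.
  by case: (eqVneq i d) => [->|_] //=; rewrite eqxx orbT.
move=> h hp; apply/setP => i; rewrite !in_content in_setU1.
by case: (eqVneq i d) => [->|_] //=;
  rewrite in_above ltnn andbF (eq_sym (pos d)) (negPf hp).
Qed.

(** Both the k-th factor and the end of the word have weight [omega k] minus the roots in
    [content D k], and the latter is the only element of its weight. *)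
Lemma fword_factors : exists y : tensor B,
  fword tf (inc D ++ rev (inc I)) pi = Some y /\
  forall k, fword (@fcr _ _ _ _ (B k)) (yword a I D rts num k) (pi k) = Some (y
    k).
Proof.
have [y [yE Sy]] := @fword_ascending [::] (inc D) erefl.
exists y; split=> // k; rewrite yword_factor.
have [z [-> z_wt z_uniq]] :=
  fword_unit_steps a_gcm (omegaP k) (@B_highest k) (factor_word_steps k) (pi_wt
    k).
congr Some; apply/esym/z_uniq; rewrite z_wt Sy; congr (_ - _).
rewrite (big_uniq _ (factor_word_uniq k)) /=; apply: eq_bigl => i.
rewrite mem_factor_word !in_content; congr (_ || _ && _).
by rewrite inE mem_inc.
Qed.

End TensorProduct.
End Forest.

Theorem proposition3p17
  (R : realType) (Delta : finType) (a : Delta -> Delta -> int)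
  (a_gcm : gcm a) (d : Delta -> nat) (a_sym : symmetrizer a d)
  (g : realization a R)
  (omega : Delta -> weight g) (rho : weight g)
  (omegaP : forall k s, omega k (coroot g s) = (k == s)%:R)
  (rhoP : forall s, rho (coroot g s) = 1)
  (omega_rho : \sum_k omega k = rho)
  (I D rts : {set Delta})
  (I_simply_laced : forall i j, i \in I -> j \in I -> i != j ->
     a i j = 0 \/ a i j = -1)
  (I_acyclic : acyclic a I)
  (D_sub_I : D \subset I)
  (lambda_dominant : forall s, exists n : nat,
     (rho *+ 2 - \sum_(i in I) sroot g i - \sum_(j in D) sroot g j)
       (coroot g s) = n%:R)
  (rtsP : root_choice a I rts)
  (num : Delta -> nat) (num_adapted : adapted a I D rts num)
  (B : Delta -> crystal g)
  (B_crystal : forall k, crystal_of_irreducible d (omega k) (B k))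
  (pi : tensor B) (pi_wt : forall k, wt (pi k) = omega k) :
  (exists y : tensor B,
     fword (tensor_f num (B := B)) (inc num D ++ rev (inc num I)) pi = Some y /\
     forall k, fword (@fcr _ _ _ _ (B k)) (yword a I D rts num k) (pi k)
               = Some (y k)) /\
  (forall m, m \in M a I D rts num -> anchor_point a I D rts num m ->
     ~~ corolla a I D rts num m -> DL_at a I D rts m = set0).
Proof.
have d_gt0 : forall s, (0 < d s)%N by case: a_sym.
have DL_parent : forall s, s \in DL a I D rts -> exists y, covers a I rts s y.
  move=> s sL.
  apply: (dead_leaf_parent a_gcm D_sub_I rtsP I_simply_laced sL).
  have [n nE] := lambda_dominant s; suff -> :
    2 - \sum_(i in I) a s i - \sum_(j in D) a s j = n%:Z by [].
  (* Dominance is given for complex values of weights; injectivity of the integers in [R[i]] brings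
     it back to Cartan integers. *)
  apply: (@intr_inj R[i]);
    rewrite -[RHS]nE !add_lfunE !opp_lfunE !sum_lfunE rhoP.
  rewrite !rmorphB !rmorph_sum /=.
  by congr (_ - _ - _); apply: eq_bigr => i _; rewrite sroot_coroot.
have B_irr k := crystal_of_irreducibleP a_gcm d_gt0 (B_crystal k).
split.
  apply: (fword_factors a_gcm I_acyclic D_sub_I rtsP num_adapted I_simply_laced
    DL_parent
    omegaP _ _ pi_wt) => k; by case: (B_irr k).
move=> m mM m_anchor m_corolla.
apply: (anchor_DL_at a_gcm I_acyclic D_sub_I rtsP num_adapted m_anchor).
by move: m_corolla; rewrite /corolla mM.
Qed.
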